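(* An asystatic locally trivial $\mathfrak g$-manifold $M$ admits a unique principal connection. This principal connection is flat (its curvature vanishes). Its horizontal space at $x\in M$ is the subspace of $T_xM$ on which the isotropy representation of $\mathfrak g_x$ vanishes.
   Context: $\mathfrak g$ is a finite-dimensional real Lie algebra. A $\mathfrak g$-manifold is a smooth manifold $M$ with a Lie algebra homomorphism $\zeta=\zeta^M:\mathfrak g\to\mathfrak X(M)$; $\mathfrak g_x=\{X\in\mathfrak g:\zeta_X(x)=0\}$ and $\mathfrak g(x)=\{\zeta_X(x):X\in\mathfrak g\}$. It is locally trivial if there are a connected manifold $S$ with a transitive $\mathfrak g$-action ($X\mapsto\zeta^S_X(s)$ onto $T_sS$ for all $s$) and a submersion $p:M\to N$ onto a smooth manifold such that each point of $N$ has an open neighborhood $U$ with a diffeomorphism $\varphi:p^{-1}(U)\to U\times S$, $\mathrm{pr}_1\circ\varphi=p$, for which $\zeta^M_X|p^{-1}(U)$ and $0\times\zeta^S_X$ are $\varphi$-related for all $X\in\mathfrak g$. It is asystatic if the normalizer satisfies $N_{\mathfrak g}(\mathfrak g_x)=\mathfrak g_x$ for every isotropy subalgebra $\mathfrak g_x$, $x\in M$. A principal connection is $\Phi\in\Omega^1(M;TM)$ such that each $\Phi_x$ is a projection of $T_xM$ onto $\mathfrak g(x)$ and $\mathcal L_{\zeta_X}\Phi=0$ for all $X\in\mathfrak g$. Its horizontal space at $x$ is $\ker\Phi_x$ and its curvature is $R(\xi,\eta)=\Phi[\xi-\Phi\xi,\eta-\Phi\eta]$. The isotropy representation of $\mathfrak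 g_x$ on $T_xM$ is given by the linearization at $x$ of the vector fields $\zeta_X$, $X\in\mathfrak g_x$ (vanishing at $x$), i.e. up to sign $X\cdot v=[\zeta_X,\tilde v](x)$ for any vector field $\tilde v$ with $\tilde v(x)=v$. *)

(* Defs.v *)
From HB Require Import structures.
From mathcomp Require Import all_boot all_order all_algebra.
From mathcomp Require Import all_classical all_reals all_analysis.
From mathcomp Require Import ring.

Set Implicit Arguments.
Unset Strict Implicit.
Unset Printing Implicit Defensive.

Import Order.TTheory GRing.Theory Num.Theory.
Import numFieldNormedType.Exports.

Local Open Scope classical_set_scope.
Local Open Scope ring_scope.

Section euclidean.
Variable R : realType.

(* [f] is of class C^k on some neighbourhood of [a]. The neighbourhood may
   shrink with [k]: a function is C^infty on an open set when it is C^k at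
   each point of that set for all [k]. *)
Fixpoint Ck_at (n k : nat) (f : 'rV[R]_n -> R) (a : 'rV[R]_n) : Prop :=
  (\forall y \near a, {for y, continuous f}) /\
  if k is k'.+1 then
    forall i : 'I_n, (\forall y \near a, derivable f y (delta_mx 0 i)) /\
      Ck_at k' ('D_(delta_mx 0 i) f) a
  else True.

Lemma Ck_at_near n k (f g : 'rV[R]_n -> R) a :
  {near a, f =1 g} -> Ck_at k f a -> Ck_at k g a.
Proof.
have near_cont (f' g' : 'rV[R]_n -> R) : {near a, f' =1 g'} ->
    (\forall y \near a, {for y, continuous f'}) ->
    \forall y \near a, {for y, continuous g'}.
  move=> /near_join fg cf; near=> y.
  have fgy : \forall z \near y, f' z = g' z by near: y.
  have cfy : {for y, continuous f'} by near: y.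
  rewrite /prop_for /continuous_at -(nbhs_singleton fgy).
  by apply: cvg_trans cfy; exact: (@near_eq_cvg _ _ (nbhs y) _ f' g' fgy).
elim: k f g => [|k IH] f g fg /= [cf df]; split => //; try exact: near_cont cf.
move=> i; have [di dfi] := df i; have fg' := near_join fg; split.
  by near=> y; apply: (@near_eq_derivable _ _ _ f); near: y.
apply: IH dfi; near=> y.
by apply: near_eq_derive; near: y.
Unshelve. all: by end_near. Qed.

Lemma Ck_atS n k (f : 'rV[R]_n -> R) a : Ck_at k.+1 f a -> Ck_at k f a.
Proof.
elim: k f => [|k IH] f /= [cf df]; split => // i.
by have [di dfi] := df i; split => //; exact: IH.
Qed.

Lemma Ck_at_cst n k (r : R) (a : 'rV[R]_n) : Ck_at k (cst r) a.
Proof.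
elim: k r => [|k IH] r /=; split => //; try by near=> y; exact: cst_continuous.
move=> i; split; first by near=> y; exact: derivable_cst.
by rewrite (_ : 'D_ _ _ = cst 0); [exact: IH | apply/funext => y; rewrite derive_cst].
Unshelve. all: by end_near. Qed.

Lemma Ck_atD n k (f g : 'rV[R]_n -> R) a :
  Ck_at k f a -> Ck_at k g a -> Ck_at k (f + g) a.
Proof.
elim: k f g => [|k IH] f g /= [cf df] [cg dg]; split => //.
1,2: by apply: filterS2 cf cg => y; exact: continuousD.
move=> i; have [dfi dfi'] := df i; have [dgi dgi'] := dg i; split.
  by apply: filterS2 dfi dgi => y; exact: derivableD.
apply: Ck_at_near (IH _ _ dfi' dgi').
by apply: filterS2 dfi dgi => y fy gy; exact: esym (deriveD fy gy).
Unshelve. all: by end_near. Qed.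

Lemma Ck_atM n k (f g : 'rV[R]_n -> R) a :
  Ck_at k f a -> Ck_at k g a -> Ck_at k (f * g) a.
Proof.
elim: k f g => [|k IH] f g /=; first move=> [cf df] [cg dg].
  by split => //; apply: filterS2 cf cg => y; exact: continuousM.
move=> Hf Hg; have Ff := @Ck_atS _ k f a Hf; have Fg := @Ck_atS _ k g a Hg.
case: Hf Hg => [cf df] [cg dg]; split.
  by apply: filterS2 cf cg => y; exact: continuousM.
move=> i; have [dfi dfi'] := df i; have [dgi dgi'] := dg i; split.
  by apply: filterS2 dfi dgi => y; exact: derivableM.
apply: Ck_at_near (Ck_atD (IH _ _ Ff dgi') (IH _ _ Fg dfi')).
by apply: filterS2 dfi dgi => y fy gy; exact: esym (deriveM fy gy).
Unshelve. all: by end_near. Qed.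

End euclidean.

Section manifold.
Variable R : realType.

(* Only the values of [cmap] on [cdom] and of [cinv] on the image of [cdom]
   are meaningful. *)
Record chart (M : topologicalType) := Chart {
  cdim : nat;
  cdom : set M;
  cmap : M -> 'rV[R]_cdim;
  cinv : 'rV[R]_cdim -> M }.
Arguments cinv {M} c _ : rename.

Record is_chart (M : topologicalType) (c : chart M) : Prop := IsChart {
  cdom_open : open (cdom c);
  cimg_open : open (cmap c @` cdom c);
  cmapK : forall x, cdom c x -> cinv c (cmap c x) = x;
  cmap_cont : forall x, cdom c x -> {for x, continuous (cmap c)};
  cinv_cont : forall x, cdom c x -> {for cmap c x, continuous (cinv c)} }.

Record charted := Charted {
  cspace :> topologicalType;
  atlas : set (chart cspace) }.

(* Finite-dimensional, but not necessarily of constant dimension. *)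
Record manifold := Manifold {
  mcharted :> charted;
  mcharts : forall c, atlas (c := mcharted) c -> is_chart c;
  mcover : forall x : mcharted, exists2 c, atlas c & cdom c x;
  mtrans : forall c d, atlas (c := mcharted) c -> atlas d ->
    forall x, cdom c x -> cdom d x ->
    forall (i : 'I_(cdim d)) k,
      Ck_at k (fun v => cmap d (cinv c v) 0 i) (cmap c x);
  mhausdorff : hausdorff_space mcharted;
  mcountable : @second_countable mcharted }.

Definition prod_chart (M N : topologicalType) (c : chart M) (d : chart N) :
    chart (M * N)%type :=
  {| cdim := cdim c + cdim d;
     cdom := cdom c `*` cdom d;
     cmap := fun z => row_mx (cmap c z.1) (cmap d z.2);
     cinv := fun v => (cinv c (lsubmx v), cinv d (rsubmx v)) |}.

Definition prod_charted (M N : charted) : charted :=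
  {| cspace := (M * N)%type;
     atlas := [set e | exists c d, [/\ atlas c, atlas d & e = prod_chart c d]] |}.

(* [f] is C^infty on some neighbourhood of [x]; nothing is required of [f]
   away from [x]. *)
Definition smooth_at (M : charted) (x : M) (f : M -> R) : Prop :=
  \forall y \near x, forall c, atlas c -> cdom c y ->
    forall k, Ck_at k (f \o cinv c) (cmap c y).

Definition smooth_map_at (M N : charted) (f : M -> N) (x : M) : Prop :=
  {for x, continuous f} /\
  forall g : N -> R, smooth_at (f x) g -> smooth_at x (g \o f).

Section smooth_at_theory.
Variable M : charted.
Implicit Types (x : M) (f g : M -> R).

Lemma smooth_at_join x f : smooth_at x f -> \forall y \near x, smooth_at y f.
Proof. exact: near_join. Qed.

Lemma smooth_at_cst x (r : R) : smooth_at x (cst r).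
Proof. by near=> y => c _ _ k; exact: Ck_at_cst. Unshelve. all: by end_near. Qed.

Lemma smooth_atD x f g : smooth_at x f -> smooth_at x g -> smooth_at x (f + g).
Proof.
move=> sf sg; near=> y => c ac cy k.
by apply: (@Ck_atD _ _ _ (f \o cinv c) (g \o cinv c));
  move: c ac cy k; near: y.
Unshelve. all: by end_near. Qed.

Lemma smooth_atM x f g : smooth_at x f -> smooth_at x g -> smooth_at x (f * g).
Proof.
move=> sf sg; near=> y => c ac cy k.
by apply: (@Ck_atM _ _ _ (f \o cinv c) (g \o cinv c));
  move: c ac cy k; near: y.
Unshelve. all: by end_near. Qed.

Lemma smooth_atZ x (r : R) f : smooth_at x f -> smooth_at x (r *: f).
Proof. by move=> sf; exact: smooth_atM (smooth_at_cst _ r) sf. Qed.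

End smooth_at_theory.

End manifold.

Section tangent.
Variable R : realType.
Implicit Types M N : charted R.

(* Derivations of the algebra of germs at [x] of smooth functions. A derivation
   is represented as a function on all of [M -> R], with the junk value 0 on the
   functions which are not smooth near [x]. *)
Definition is_derivation M (x : M) (v : (M -> R) -> R) : Prop :=
  [/\ forall f, ~ smooth_at x f -> v f = 0,
      forall f g, smooth_at x f -> smooth_at x g ->
        {near x, f =1 g} -> v f = v g,
      forall (r : R) f g, smooth_at x f -> smooth_at x g ->
        v (r *: f + g) = r * v f + v g &
      forall f g, smooth_at x f -> smooth_at x g ->
        v (f * g) = f x * v g + g x * v f].

Definition derivation M (x : M) : {pred (M -> R) -> R} :=
  fun v => `[< is_derivation x v >].

Record tangent M (x : M) := Tangent {
  tfun :> (M -> R) -> R;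
  tfunP : tfun \in derivation x }.

Lemma derivation_submod M (x : M) : submod_closed (derivation x).
Proof.
split=> [|r u v /asboolP[u0 ug ul uL] /asboolP[v0 vg vl vL]]; apply/asboolP;
  split => //.
- by move=> s f g _ _; change (0 = s * 0 + 0 :> R); rewrite mulr0 addr0.
- by move=> f g _ _; change (0 = f x * 0 + g x * 0); rewrite !mulr0 addr0.
- by move=> f nf; change (r * u f + v f = 0); rewrite (u0 _ nf) (v0 _ nf) mulr0 add0r.
- move=> f g sf sg fg; rewrite [LHS]/(r * u f + v f) [RHS]/(r * u g + v g).
  by rewrite (ug f g) // (vg f g).
- move=> s f g sf sg; change (r * u (s *: f + g) + v (s *: f + g) =
    s * (r * u f + v f) + (r * u g + v g)).
  by rewrite (ul _ _ _ sf sg) (vl _ _ _ sf sg); ring.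
- move=> f g sf sg; change (r * u (f * g) + v (f * g) =
    f x * (r * u g + v g) + g x * (r * u f + v f)).
  by rewrite (uL _ _ sf sg) (vL _ _ sf sg); ring.
Qed.

HB.instance Definition _ M (x : M) :=
  GRing.isSubmodClosed.Build R ((M -> R) -> R) (derivation x)
    (derivation_submod x).
HB.instance Definition _ M (x : M) := [isSub for @tfun M x].
HB.instance Definition _ M (x : M) := [Choice of tangent x by <:].
HB.instance Definition _ M (x : M) := [SubChoice_isSubLmodule of tangent x by <:].

(* The tangent vector at [x] acting as [D] on the functions smooth near [x];
   junk value 0 if there is none. *)
Definition mk_tangent M (x : M) (D : (M -> R) -> R) : tangent x :=
  insubd 0 (fun f => if `[< smooth_at x f >] then D f else 0).

Definition differential M N (f : M -> N) (x : M) (v : tangent x) :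
    tangent (f x) :=
  mk_tangent (f x) (fun g => v (g \o f)).

(* Arbitrary sections of the tangent bundle. A vector field on an open set is
   represented by any section which is smooth at the points of that set. *)
Definition field M := forall x : M, tangent x.

Definition smooth_field_at M (xi : field M) (x : M) : Prop :=
  \forall y \near x, forall f : M -> R,
    smooth_at y f -> smooth_at y (fun z => xi z f).

Definition bracket M (xi eta : field M) : field M := fun x =>
  mk_tangent x (fun f => xi x (fun y => eta y f) - eta x (fun y => xi y f)).

(* The vector field 0 x eta on the product, eta being pushed forward along the
   slices n |-> (m, n). *)
Definition zero_prod M N (eta : field N) : field (prod_charted M N) :=
  fun z => let: (m, n) as z' := z return @tangent (prod_charted M N) z' in
    @differential N (prod_charted M N) (pair m) n (eta n).

Definition submersion M N (p : M -> N) : Prop :=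
  (forall x, smooth_map_at p x) /\
  forall x (w : tangent (p x)), exists v : tangent x, differential p v = w.

Section tangent_theory.
Variable M : charted R.
Implicit Types x : M.

Lemma mk_tangentE x (D : (M -> R) -> R) f :
  (forall f g, smooth_at x f -> smooth_at x g -> {near x, f =1 g} -> D f = D g) ->
  (forall (r : R) f g, smooth_at x f -> smooth_at x g ->
    D (r *: f + g) = r * D f + D g) ->
  (forall f g, smooth_at x f -> smooth_at x g ->
    D (f * g) = f x * D g + g x * D f) ->
  smooth_at x f -> mk_tangent x D f = D f.
Proof.
move=> Dg Dl DL sf.
have H g : smooth_at x g -> (if `[< smooth_at x g >] then D g else 0) = D g.
  by case: asboolP.
rewrite /mk_tangent; set E := (X in insubd _ X).
have dE : E \in derivation x.
  apply/asboolP; split; rewrite /E.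
  - by move=> g; case: asboolP.
  - by move=> g h sg sh gh; rewrite !H //; exact: Dg.
  - move=> r g h sg sh; rewrite !H //; first exact: Dl.
    exact: smooth_atD (smooth_atZ _ _) _.
  - move=> g h sg sh; rewrite !H //; first exact: DL.
    exact: smooth_atM.
by rewrite -[LHS]/(val (insubd (0 : tangent x) E) f) (insubdK _ dE) /E H.
Qed.

Lemma tangentP x (v : tangent x) : is_derivation x v.
Proof. exact/asboolP/tfunP. Qed.

Lemma smooth_field_near (xi : field M) x f g : smooth_field_at xi x ->
  smooth_at x f -> smooth_at x g -> {near x, f =1 g} ->
  \forall y \near x, xi y f = xi y g.
Proof.
move=> sxi /smooth_at_join sf /smooth_at_join sg /near_join fg; near=> y.
by have [_ e _ _] := tangentP (xi y); apply: e; near: y.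
Unshelve. all: by end_near. Qed.

Lemma smooth_field_app (xi : field M) x f : smooth_field_at xi x ->
  smooth_at x f -> smooth_at x (fun y => xi y f).
Proof. by move=> /nbhs_singleton; apply. Qed.

Lemma field_linear (xi eta : field M) x (r : R) f g :
  smooth_field_at eta x -> smooth_at x f -> smooth_at x g ->
  xi x (fun y => eta y (r *: f + g)) =
  r * xi x (fun y => eta y f) + xi x (fun y => eta y g).
Proof.
move=> se sf sg; have [_ ge li _] := tangentP (xi x).
have sef := smooth_field_app se sf; have seg := smooth_field_app se sg.
rewrite -(li _ _ _ sef seg); apply: ge.
- by apply: smooth_field_app se _; exact: smooth_atD (smooth_atZ _ sf) sg.
- exact: smooth_atD (smooth_atZ _ sef) seg.
apply: filterS2 (smooth_at_join sf) (smooth_at_join sg) => y fy gy.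
by have [_ _ l _] := tangentP (eta y); exact: l.
Qed.

Lemma field_leibniz (xi eta : field M) x f g :
  smooth_field_at eta x -> smooth_at x f -> smooth_at x g ->
  xi x (fun y => eta y (f * g)) =
  f x * xi x (fun y => eta y g) + eta x g * xi x f +
  (g x * xi x (fun y => eta y f) + eta x f * xi x g).
Proof.
move=> se sf sg; have [_ ge li le] := tangentP (xi x).
have sef := smooth_field_app se sf; have seg := smooth_field_app se sg.
rewrite -(le _ _ sf seg) -(le _ _ sg sef).
have sfg := smooth_atM sf seg; have sgf := smooth_atM sg sef.
rewrite -[xi x (f * _)]mul1r -(li _ _ _ sfg sgf); apply: ge.
- by apply: smooth_field_app se _; exact: smooth_atM.
- exact: smooth_atD (smooth_atZ _ sfg) sgf.
apply: filterS2 (smooth_at_join sf) (smooth_at_join sg) => y fy gy.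
by have [_ _ _ l] := tangentP (eta y); rewrite (l _ _ fy gy) scale1r.
Qed.

Lemma bracketE (xi eta : field M) x f :
  smooth_field_at xi x -> smooth_field_at eta x -> smooth_at x f ->
  bracket xi eta x f = xi x (fun y => eta y f) - eta x (fun y => xi y f).
Proof.
move=> sxi se; apply: mk_tangentE => [{}f g sf sg fg|r {}f g sf sg|{}f g sf sg].
- have [_ gx _ _] := tangentP (xi x); have [_ gy _ _] := tangentP (eta x).
  by congr (_ - _); [apply: gx|apply: gy]; try exact: smooth_field_app;
    exact: smooth_field_near.
- by rewrite !field_linear //; ring.
- by rewrite !field_leibniz //; ring.
Qed.

End tangent_theory.

Lemma differentialE M N (f : M -> N) x (v : tangent x) (g : N -> R) :
  smooth_map_at f x -> smooth_at (f x) g -> differential f v g = v (g \o f).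
Proof.
move=> [cf sf]; have [_ ge li le] := tangentP v.
apply: mk_tangentE => [{}g h sg sh gh|r {}g h sg sh|{}g h sg sh].
- by apply: ge; [exact: sf|exact: sf|exact: cf gh].
- by rewrite -li //; exact: sf.
- by rewrite [LHS]le //; exact: sf.
Qed.

End tangent.

Section g_manifold.
Variable R : realType.

Record lieAlgebra := LieAlgebra {
  lvect :> vectType R;
  lie : lvect -> lvect -> lvect;
  lie_linearl : forall (r : R) X Y Z, lie (r *: X + Y) Z = r *: lie X Z + lie Y Z;
  lie_linearr : forall (r : R) X Y Z, lie Z (r *: X + Y) = r *: lie Z X + lie Z Y;
  liexx : forall X, lie X X = 0;
  lie_jacobi : forall X Y Z,
    lie X (lie Y Z) + lie Y (lie Z X) + lie Z (lie X Y) = 0 }.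

Variable g : lieAlgebra.

Definition normalizer (h : set g) : set g :=
  [set X | forall Y, h Y -> h (lie X Y)].

Record gmanifold := GManifold {
  gcarrier :> manifold R;
  zeta : g -> field gcarrier;
  zeta_smooth : forall X x, smooth_field_at (zeta X) x;
  zeta_linear : forall (r : R) X Y x,
    zeta (r *: X + Y) x = r *: zeta X x + zeta Y x;
  zeta_bracket : forall X Y x,
    zeta (lie X Y) x = bracket (zeta X) (zeta Y) x }.

Section notions.
Variable M : gmanifold.

Definition isotropy (x : M) : set g := [set X | zeta X x = 0].

Definition orbit_space (x : M) : set (tangent x) := range (fun X => zeta X x).
Arguments orbit_space x : clear implicits.

Definition transitive : Prop :=
  forall (s : M) (v : tangent s), exists X, zeta X s = v.

Definition asystatic : Prop :=
  forall x : M, normalizer (isotropy x) = isotropy x.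

(* X.v = [zeta_X, v~](x) for any extension v~ of v; since zeta_X vanishes at x,
   this only depends on v, see isotropy_repE. *)
Definition isotropy_rep (x : M) (X : g) (v : tangent x) : tangent x :=
  mk_tangent x (fun f => - v (fun y => zeta X y f)).

Lemma isotropy_repE (x : M) (X : g) (xi : field M) : isotropy x X ->
  smooth_field_at xi x -> isotropy_rep X (xi x) = bracket (zeta X) xi x.
Proof.
move=> X0 sxi; rewrite /isotropy_rep /bracket; congr mk_tangent.
by apply/funext => f; rewrite X0; change (- xi x (fun y => zeta X y f) =
  0 - xi x (fun y => zeta X y f)); rewrite sub0r.
Qed.

(* Omega^1(M; TM); smoothness is tested on local vector fields. *)
Record form1 := Form1 {
  form :> forall x : M, {linear tangent x -> tangent x};
  form_smooth : forall x xi, smooth_field_at xi x ->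
    smooth_field_at (fun y => form y (xi y)) x }.

Definition lie_derivative (xi : field M) (Phi : form1) (eta : field M) :
    field M := fun x =>
  bracket xi (fun y => Phi y (eta y)) x - Phi x (bracket xi eta x).

Record principal_connection (Phi : form1) : Prop := PrincipalConnection {
  conn_idem : forall x v, Phi x (Phi x v) = Phi x v;
  conn_range : forall x, range (Phi x) = orbit_space x;
  conn_invariant : forall X x eta, smooth_field_at eta x ->
    lie_derivative (zeta X) Phi eta x = 0 }.

Definition horizontal_space (Phi : form1) (x : M) : set (tangent x) :=
  [set v | Phi x v = 0].

Definition isotropy_null (x : M) : set (tangent x) :=
  [set v | forall X, isotropy x X -> isotropy_rep X v = 0].

Definition curvature (Phi : form1) (xi eta : field M) : field M := fun x =>
  Phi x (bracket (fun y => xi y - Phi y (xi y)) (fun y => eta y - Phi y (eta y)) x).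

Definition flat (Phi : form1) : Prop :=
  forall x xi eta, smooth_field_at xi x -> smooth_field_at eta x ->
    curvature Phi xi eta x = 0.

End notions.

(* A diffeomorphism p^-1(U) -> U x S and its inverse are represented by maps
   phi and psi defined everywhere but constrained only on these open sets. The
   last clause says that zeta^M_X and 0 x zeta^S_X are phi-related. *)
Definition local_trivialization (M S : gmanifold) (N : manifold R) (p : M -> N)
    (U : set N) (phi : M -> prod_charted N S) (psi : prod_charted N S -> M) :
    Prop :=
  [/\ forall x, U (p x) -> (phi x).1 = p x,
      forall x, U (p x) -> smooth_map_at phi x /\ psi (phi x) = x,
      forall z, U z.1 ->
        [/\ smooth_map_at psi z, U (p (psi z)) & phi (psi z) = z] &
      forall X x, U (p x) ->
        differential phi (zeta X x) = zero_prod (zeta X) (phi x)].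

Definition locally_trivial (M : gmanifold) : Prop :=
  exists (S : gmanifold) (N : manifold R) (p : M -> N),
    [/\ connected [set: S], transitive S, submersion p,
        (forall n, exists x, p x = n) &
        forall n, exists (U : set N) (phi : M -> prod_charted N S)
            (psi : prod_charted N S -> M),
          [/\ open U, U n & local_trivialization p U phi psi]].

End g_manifold.

Arguments orbit_space {R g M} x.
Arguments horizontal_space {R g M} Phi x.
Arguments isotropy_null {R g M} x.

(* Main.v *)
Require Import Defs.
From HB Require Import structures.
From mathcomp Require Import all_boot all_order all_algebra.
From mathcomp Require Import all_classical all_reals all_analysis.
From mathcomp Require Import perm.

Set Implicit Arguments.
Unset Strict Implicit.
Unset Printing Implicit Defensive.

Import Order.TTheory GRing.Theory Num.Theory.
Import numFieldNormedType.Exports.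

Local Open Scope classical_set_scope.
Local Open Scope ring_scope.

(** Fix a trivialization [phi : p^-1(U) -> U x S] and let [sigma] be its second
    component. Each [zeta_X] is [sigma]-related to the field [zeta_X] of [S] and
    [p]-related to 0. Call a tangent vector vertical if it kills all functions
    [f o p], horizontal if it kills all functions [f o sigma].

    The coordinates of the product charts are functions of these two kinds, so
    a vector that is both vertical and horizontal is zero
    ([vertical_horizontal_eq0]). Since [S] is transitive, every vector becomes
    horizontal after subtraction of some [zeta_X(x)] ([horizontal_part]). Hence
    [T_x M] is the direct sum of [g(x)], which is the space of vertical vectors
    ([vertical_orbit]), and the space of horizontal vectors.

    The splitting does not depend on the trivialization, because the horizontal
    vectors at [x] are those on which the isotropy representation vanishes. If
    [v] is horizontal and [X] is in [g_x], then [X.v] is both vertical and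
    horizontal ([horizontal_null]). Conversely, if the isotropy representation
    vanishes on [zeta_Y(x)], then [Y] normalizes [g_x], so [zeta_Y(x) = 0] for
    an asystatic action ([orbit_null_eq0], [null_horizontal]). The projection
    onto [g(x)] along this complement is the connection. It is smooth, since
    near a point it is a combination of finitely many fundamental fields whose
    coefficients are obtained by inverting a smooth matrix
    ([horizontal_part_smooth]).

    Fields that kill the pull-backs by a fixed map are closed under brackets
    ([bracket_kill]). For [sigma] this is flatness. For [p] it says that
    [[zeta_X, Phi eta]] is vertical, and since [zeta_X] is [sigma]-related to a
    field of [S], [[zeta_X, eta - Phi eta]] is horizontal: this is invariance
    ([orbit_connection_principal]). For uniqueness, an invariant projection
    [Psi] has a kernel stable under [g_x]; but [X.v] is always vertical, hence
    fixed by [Psi], so [X.v = 0] on [ker Psi] ([orbit_connection_unique]).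

    Tangent vectors are derivations of germs of smooth functions, so two facts
    of calculus are needed: a derivation is determined by its values on the
    coordinates of a chart ([tangent_chart_eq0]), which rests on Hadamard's
    lemma ([hadamard]), and smoothness can be tested in a single chart
    ([smooth_of_chart]), which rests on the chain rule ([Ck_at_comp]). *)

(** * Functions of class C^k and the chain rule *)

Section class_Ck.
Variable R : realType.

Lemma Ck_at_join n k (f : 'rV[R]_n -> R) a :
  Ck_at k f a -> \forall y \near a, Ck_at k f y.
Proof.
elim: k f => [|k IH] f /= [cf df].
  by apply: filterS (near_join cf) => y cy; split.
have dn : \forall y \near a, forall i : 'I_n,
    (\forall z \near y, derivable f z (delta_mx 0 i)) /\
    Ck_at k ('D_(delta_mx 0 i) f) y.
  apply: (@filter_forall _ _ _ (nbhs a)) => i; have [d1 d2] := df i.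
  by apply: filterS2 (near_join d1) (IH _ d2) => y.
by apply: filterS2 (near_join cf) dn => y.
Qed.

Lemma Ck_at_le n k l (f : 'rV[R]_n -> R) a :
  (k <= l)%N -> Ck_at l f a -> Ck_at k f a.
Proof.
elim: l => [|l IH]; first by rewrite leqn0 => /eqP->.
by rewrite leq_eqVlt => /predU1P[->//|kl /Ck_atS]; exact: IH.
Qed.

Lemma Ck_at_continuous n k (f : 'rV[R]_n -> R) a :
  Ck_at k f a -> {for a, continuous f}.
Proof. by case: k => [|k] /= [/nbhs_singleton]. Qed.

Lemma Ck_at_sum n k (I : Type) (r : seq I) (P : pred I)
    (F : I -> 'rV[R]_n -> R) a :
  (forall i, P i -> Ck_at k (F i) a) -> Ck_at k (\sum_(i <- r | P i) F i) a.
Proof.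
move=> H; apply: (big_ind (fun f => Ck_at k f a)) => //.
  exact: (Ck_at_cst k 0).
by move=> f g; exact: Ck_atD.
Qed.

Lemma is_derive_line n (f : 'rV[R]_n -> R) (c e : 'rV[R]_n) (r s : R) :
  derivable f (c + (s * r) *: e) e ->
  is_derive s 1 (fun t => f (c + (t * r) *: e))
    (r * 'D_e f (c + (s * r) *: e)).
Proof.
move=> df.
pose F u := f (c + u *: e).
have FE u h : h^-1 *: (F (h *: 1 + u) - F u) =
    h^-1 *: (f (h *: e + (c + u *: e)) - f (c + u *: e)).
  congr (_ *: (f _ - _)).
  by rewrite scaler1 scalerDl addrCA.
have dF : is_derive (s * r) 1 F ('D_e f (c + (s * r) *: e)).
  apply: DeriveDef.
    by rewrite /derivable; under eq_fun do rewrite FE.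
  by rewrite /derive; under eq_fun do rewrite FE.
have dm : is_derive s (1:R) ( *%R^~ r) r.
  rewrite (_ : *%R^~ r = r *: id); last by apply/funext => x; exact: mulrC.
  by apply: is_derive_eq; exact: mulr1.
by have := @is_derive1_comp _ F ( *%R^~ r) s _ _ dF dm; rewrite mulrC.
Qed.

End class_Ck.

Section frechet.
Variable R : realType.

Lemma rV_normP n (h : 'rV[R]_n) r : 0 < r ->
  reflect (forall i, `|h 0 i| < r) (`|h| < r).
Proof.
move=> r0; have E : (`|h| < r) <-> (forall i, `|h 0 i| < r).
  rewrite -[h]opprK -[- - h]sub0r.
  change (ball_ Num.norm 0 r (- h) <-> forall i, `|(0 - - h) 0 i| < r).
  rewrite -mx_norm_ball; split.
    by move=> [_ +] i => /(_ 0 i); rewrite /ball /= !mxE sub0r.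
  by move=> H; split => // i j; rewrite ord1 /ball /= ; move: (H j);
    rewrite !mxE sub0r.
by apply: (iffP idP) => /E.
Qed.

Lemma rV_coord_le n (h : 'rV[R]_n) i : `|h 0 i| <= `|h|.
Proof.
apply/ler_addgt0Pr => e e0; apply/ltW.
by have /rV_normP -> // : `|h| < `|h| + e; rewrite ?ltrDl // ltr_pwDr.
Qed.

(** A step from [a] to [a + h] is decomposed into [n] steps along the axes. The
    mean value theorem turns each of them into a partial derivative at a nearby
    point, and continuity replaces that point by [a]. *)
Lemma C1_differentiable n (f : 'rV[R]_n -> R) a :
  Ck_at 1 f a -> differentiable f a.
Proof.
move=> /= [_ df].
pose D (i : 'I_n) : 'rV[R]_n -> R := 'D_(delta_mx 0 i) f.
have Llin : linear (fun h : 'rV[R]_n => \sum_i h 0 i * D i a).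
  move=> r u v; rewrite scaler_sumr -big_split; apply: eq_bigr => i _.
  by rewrite !mxE mulrDl -mulrA.
pose Lm := GRing.isLinear.Build _ _ _ _ _ Llin.
pose L : {linear 'rV[R]_n -> R} :=
  HB.pack (fun h : 'rV[R]_n => \sum_i h 0 i * D i a) Lm.
have Lc : continuous L.
  move=> x; apply: differentiable_continuous.
  rewrite (_ : (L : _ -> _) = \sum_i (fun h : 'rV[R]_n => h 0 i *: D i a)).
    by apply: differentiable_sum => i; apply: differentiableZl;
      exact: differentiable_coord.
  by apply/funext => h; rewrite fct_sumE.
have dfL := @diff_unique _ _ _ f L a Lc.
suff dxf : f \o shift a = cst (f a) + (L : 'rV[R]_n -> R) +o_ (0 : 'rV[R]_n) id.
  by apply/diff_locallyP; rewrite (dfL dxf).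
apply/eqaddoP => e e0.
have e'0 : 0 < e / n.+1%:R by rewrite divr_gt0.
have : \forall y \near a, forall i : 'I_n, derivable f y (delta_mx 0 i) /\
    `|D i a - D i y| < e / n.+1%:R.
  apply: (@filter_forall _ _ _ (nbhs a)) => i;
    have [d1 [/nbhs_singleton d2 _]] := df i.
  apply: filterI => //.
  by move/cvgrPdist_lt : d2 => /(_ _ e'0).
move=> /nbhs_ballP[r r0 Hr].
apply/nbhs_ballP; exists r => //= h; rewrite -ball_normE /= sub0r normrN => hr.
(* [a + P k] is the point reached after the first [k] steps. *)
pose P k : 'rV[R]_n := \row_j (if (j < k)%N then h 0 j else 0).
have PS (i : 'I_n) : P i.+1 = P i + h 0 i *: delta_mx 0 i.
  apply/rowP => j; rewrite !mxE /= ltnS leq_eqVlt -[(j == i :> nat)]/(j == i).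
  by case: eqVneq => [->|_] /=; rewrite ?ltnn ?mulr1 ?mulr0 ?addr0 ?add0r.
have Pb (i : 'I_n) (s : R) : 0 <= s <= 1 ->
  ball a r (a + (P i + (s * h 0 i) *: delta_mx 0 i)).
  move=> /andP[s0 s1]; rewrite -ball_normE /= opprD addNKr normrN;
    apply/rV_normP => // j.
  rewrite !mxE /=; apply: le_lt_trans hr.
  case: eqVneq => [->|_]; rewrite ?ltnn ?mulr1 ?mulr0 ?addr0 ?add0r.
    rewrite normrM (ger0_norm s0); apply: le_trans (rV_coord_le h i).
    by rewrite ler_piMl.
  by case: ifP => _; rewrite ?normr0// rV_coord_le.
have tele : f (h + a) - f a = \sum_(i < n) (f (a + P i.+1) - f (a + P i)).
  rewrite -(big_mkord predT (fun i => f (a + P i.+1) - f (a + P i))).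
  rewrite (@telescope_sumr _ 0 n (fun i => f (a + P i)))//; congr (f _ - f _).
    by rewrite addrC; congr (_ + _); apply/rowP => j; rewrite mxE ltn_ord.
  by rewrite -[LHS]addr0; congr (_ + _); apply/rowP => j; rewrite !mxE.
have -> : (f \o shift a - (cst (f a) + L)) h =
   \sum_(i < n) (f (a + P i.+1) - f (a + P i) - h 0 i * D i a).
  by rewrite big_split /= sumrN -tele -[LHS]/(f (h + a) - (f a + L h)) opprD
    addrA.
apply: le_trans (ler_norm_sum _ _ _) _.
have est (i : 'I_n) :
    `|f (a + P i.+1) - f (a + P i) - h 0 i * D i a| <= e / n.+1%:R * `|h|.
  have dd (s : R) : 0 <= s <= 1 ->
    is_derive s 1 (fun t => f ((a + P i) + (t * h 0 i) *: delta_mx 0 i))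
     (h 0 i * D i ((a + P i) + (s * h 0 i) *: delta_mx 0 i)).
    move=> s01; apply: is_derive_line.
    by have [] := Hr _ (Pb i _ s01) i; rewrite addrA.
  have [|||s s01] := @MVT_segment R (fun t =>
    f ((a + P i) + (t * h 0 i) *: delta_mx 0 i))
     (fun s => (h 0 i * D i ((a + P i) + (s * h 0 i) *: delta_mx 0 i))) 0 1.
  - by [].
  - move=> s; rewrite in_itv /= => /andP[s0 s1]; apply: dd.
    by rewrite !ltW.
  - apply: derivable_within_continuous => s; rewrite in_itv /= => s01.
    by have [] := dd s s01.
  rewrite mul1r mul0r scale0r addr0 subr0 mulr1 -addrA -PS => ->.
  rewrite -mulrBr normrM mulrC distrC; apply: ler_pM => //;
    last exact: rV_coord_le.
  have s01' : 0 <= s <= 1 by rewrite (itvP s01) /= (itvP s01).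
  by have [_ /ltW] := Hr _ (Pb i s s01') i; rewrite addrA.
apply: le_trans (ler_sum _ (fun i _ => est i)) _.
rewrite sumr_const card_ord -[leLHS]mulr_natl mulrA ler_wpM2r //.
rewrite mulrC -mulrA ler_piMr ?(ltW e0) // mulrC ler_pdivrMr// mul1r ler_nat//.
Qed.

End frechet.

Section composition.
Variable R : realType.

Lemma rV_continuous (T : topologicalType) n (h : T -> 'rV[R]_n) y :
  (forall j, {for y, continuous (fun v => h v 0 j)}) -> {for y, continuous h}.
Proof.
move=> H; apply/(@cvgrPdist_lt _ _ _ (nbhs y)) => e e0.
have : \forall z \near y, forall j, `|h y 0 j - h z 0 j| < e.
  by apply: (@filter_forall _ _ _ (nbhs y)) => j; have /cvgrPdist_lt := H j;
    exact.
by apply: filterS => z Hz; apply/rV_normP => // j; rewrite !mxE.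
Qed.

Lemma rV_differentiable m n (h : 'rV[R]_m -> 'rV[R]_n) y :
  (forall j, differentiable (fun v => h v 0 j) y) -> differentiable h y.
Proof.
move=> H; rewrite (_ : h = \sum_j (fun v => h v 0 j *: delta_mx 0 j)).
  by apply: differentiable_sum => j; apply: differentiableZl.
by apply/funext => v; rewrite fct_sumE [LHS]row_sum_delta.
Qed.

Lemma derive_comp_rV m n (g : 'rV[R]_n -> R) (h : 'rV[R]_m -> 'rV[R]_n) y e :
  (forall j, differentiable (fun v => h v 0 j) y) -> differentiable g (h y) ->
  'D_e (g \o h) y =
  \sum_j 'D_(delta_mx 0 j) g (h y) * 'D_e (fun v => h v 0 j) y.
Proof.
move=> Hh Hg; have dh := rV_differentiable Hh.
have dgh : differentiable (g \o h) y by exact: differentiable_comp.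
rewrite deriveE // diff_comp // /comp -[in 'd h y e]deriveE //.
rewrite derive_mx; last exact: diff_derivable.
rewrite [X in 'd g (h y) X]row_sum_delta linear_sum; apply: eq_bigr => j _.
by rewrite linearZ /= mxE mulrC (deriveE _ (Hh j)) (deriveE _ Hg).
Qed.

(** The partial derivatives of a composite are sums of products of a composite
    and a derivative, all of them one class lower: induct on [k]. *)
Lemma Ck_at_comp m n k (g : 'rV[R]_n -> R) (h : 'rV[R]_m -> 'rV[R]_n) b :
  (forall j, Ck_at k (fun v => h v 0 j) b) -> Ck_at k g (h b) ->
  Ck_at k (g \o h) b.
Proof.
have contgh (g' : 'rV[R]_n -> R) l : (forall j, Ck_at l (fun v => h v 0 j) b) ->
    Ck_at l g' (h b) -> \forall y \near b, {for y, continuous (g' \o h)}.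
  move=> Hh Hg.
  have ch : \forall y \near b, {for y, continuous h}.
    have : \forall y \near b, forall j, {for y, continuous (fun v => h v 0 j)}.
      by apply: (@filter_forall _ _ _ (nbhs b)) => j;
        case: l {Hg} Hh => [|l] /(_ j)[].
    by apply: filterS => y; exact: rV_continuous.
  have cg : \forall y \near h b, {for y, continuous g'}.
    by case: l Hg {Hh} => [|l] [].
  have cg' : \forall y \near b, {for h y, continuous g'}.
    by have /nbhs_singleton hb := ch; exact: hb cg.
  by apply: filterS2 ch cg' => y c1 c2; exact: continuous_comp.
elim: k g => [|k IH] g Hh Hg; first by split => //; exact: (contgh _ 0%N).
split; first exact: contgh Hg.
move=> i.
have dh : \forall y \near b, forall j, differentiable (fun v => h v 0 j) y.
  apply: (@filter_forall _ _ _ (nbhs b)) => j.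
  have H1 := @Ck_at_le R _ 1 k.+1 _ _ isT (Hh j).
  by apply: filterS (Ck_at_join H1) => y; exact: C1_differentiable.
have ch : {for b, continuous h}.
  by apply: rV_continuous => j; exact: Ck_at_continuous (Hh j).
have dg : \forall y \near b, differentiable g (h y).
  have H1 := @Ck_at_le R _ 1 k.+1 _ _ isT Hg.
  have dg : \forall z \near h b, differentiable g z.
    by apply: filterS (Ck_at_join H1) => y; exact: C1_differentiable.
  exact: ch dg.
split.
  apply: filterS2 dh dg => y h1 h2; apply: diff_derivable.
  by apply: differentiable_comp => //; exact: rV_differentiable.
apply: (@Ck_at_near _ _ _ (\sum_j (('D_(delta_mx 0 j) g \o h) *
    'D_(delta_mx 0 i) (fun v => h v 0 j)))).
  by apply: filterS2 dh dg => y h1 h2; rewrite derive_comp_rV // fct_sumE.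
apply: Ck_at_sum => j _; apply: Ck_atM.
  by apply: IH => [l|]; [exact: Ck_atS (Hh l)|case: Hg => _ /(_ j)[]].
by case: (Hh j) => _ /(_ i)[].
Qed.

Lemma is_derive_coord n (i j : 'I_n) (y : 'rV[R]_n) :
  is_derive y (delta_mx 0 i) (fun v : 'rV[R]_n => v 0 j) (i == j)%:R.
Proof.
apply: DeriveDef; first exact/diff_derivable/differentiable_coord.
apply/cvg_lim => //.
rewrite (_ : (fun h : R => _) = (fun h => h^-1 * (h * (i == j)%:R))).
  apply: cvg_near_cst; near=> h; rewrite mulrA mulVf ?mul1r//.
  by near: h; exact: nbhs_dnbhs_neq.
by apply/funext => h /=; rewrite !mxE /= addrK eq_sym.
Unshelve. all: by end_near. Qed.

Lemma Ck_at_coord n k (j : 'I_n) a : Ck_at k (fun v : 'rV[R]_n => v 0 j) a.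
Proof.
have c : continuous (fun v : 'rV[R]_n => v 0 j) by exact: coord_continuous.
have nc : \forall y \near a, {for y, continuous (fun v : 'rV[R]_n => v 0 j)}.
  by near=> y; exact: c.
case: k => [|k]; split=> //.
move=> i; split; first by near=> y; case: (is_derive_coord i j y).
rewrite (_ : 'D_(delta_mx 0 i) (fun v : 'rV[R]_n => v 0 j) =
    cst ((i == j)%:R : R)).
  exact: Ck_at_cst.
by apply/funext => y; have [_ ->] := is_derive_coord i j y.
Unshelve. all: by end_near. Qed.

Lemma Ck_atV n k (f : 'rV[R]_n -> R) a :
  f a != 0 -> Ck_at k f a -> Ck_at k (fun y => (f y)^-1) a.
Proof.
move=> fa0 Hf.
have near0 : \forall y \near a, f y != 0.
  exact: cvgr_neq0 (Ck_at_continuous Hf) fa0.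
elim: k f Hf fa0 near0 => [|k IH] f Hf fa0 near0.
  split => //; case: Hf => cf _; apply: filterS2 cf near0 => y h1 h2;
    exact: (cvgV h2 h1).
have Ff := Ck_atS Hf; have Vf := IH f Ff fa0 near0.
case: Hf => cf df; split.
  by apply: filterS2 cf near0 => y h1 h2; exact: (cvgV h2 h1).
move=> i; have [d1 d2] := df i; split.
  by apply: filterS2 d1 near0 => y h1 h2; exact: derivableV.
apply: (@Ck_at_near _ _ _ (cst (-1) *
    ((fun y => (f y)^-1) * (fun y => (f y)^-1)) * 'D_(delta_mx 0 i) f)).
  apply: filterS2 d1 near0 => y h1 h2; rewrite deriveV //.
  rewrite -exprVn expr2 scaleNr -[RHS]/(- ((f y)^-1 * (f y)^-1 * _)).
  by rewrite -mulNr -[in RHS]mulN1r.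
apply: Ck_atM => //; apply: Ck_atM; first exact: Ck_at_cst.
exact: Ck_atM.
Qed.

End composition.

(** * Hadamard's lemma *)

Section hadamard.
Variable R : realType.

Variables (n : nat) (a : 'rV[R]_n) (r : R).
Local Notation mu := (@lebesgue_measure R).
Local Notation seg y t := (a + t *: (y - a)).
Local Notation B := (ball a r).
Implicit Types (h : 'rV[R]_n -> R) (y : 'rV[R]_n).

(** The mean of [h] over the segment from [a] to [y]. The weight [t ^+ m] makes
    the family stable under differentiation in [y], as each derivative produces
    a factor [t]. *)
Definition ray_mean m h y : R :=
  \int[mu]_(t in `[0, 1]) (t ^+ m * h (seg y t)).

Lemma ball_seg y (t : R) : B y -> `[0, 1]%classic t -> B (seg y t).
Proof.
rewrite -ball_normE /= => By; rewrite in_itv /= => /andP[t0 t1].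
rewrite opprD addNKr normrN normrZ ger0_norm //.
by rewrite distrC in By; apply: le_lt_trans By; rewrite ler_piMl.
Qed.

Lemma seg_cvg y (t : R) :
  seg z.2 z.1 @[z --> (nbhs t, nbhs y)] --> seg y t.
Proof.
apply: cvgD; first exact: cvg_cst.
apply: cvgZ; first exact: cvg_fst.
by apply: cvgB; [exact: cvg_snd|exact: cvg_cst].
Qed.

(** Compactness of [[0, 1]] makes the continuity of [h] along the segment
    uniform in [t]. *)
Lemma ray_uniform h y e : (forall z, B z -> {for z, continuous h}) -> B y ->
  0 < e ->
  \forall z \near y, forall t : R, `[0, 1]%classic t ->
    `|h (seg y t) - h (seg z t)| < e.
Proof.
move=> ch By e0.
have /compact_near_coveringP/(_ _ (nbhs y)
  (fun z t => `|h (seg y t) - h (seg z t)| < e)) := @segment_compact R 0 1.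
apply => t t01.
have chs : {for seg y t, continuous h} by apply: ch; exact: ball_seg.
have c1 : h (seg z.2 z.1) @[z --> (nbhs t, nbhs y)] --> h (seg y t).
  exact: (cvg_comp _ _ (@seg_cvg y t) chs).
have c2 : h (seg y z.1) @[z --> (nbhs t, nbhs y)] --> h (seg y t).
  have c0 : seg y z.1 @[z --> (nbhs t, nbhs y)] --> seg y t.
    apply: cvgD; first exact: cvg_cst.
    by apply: cvgZr_tmp; exact: cvg_fst.
  exact: (cvg_comp _ _ c0 chs).
have c3 : h (seg y z.1) - h (seg z.2 z.1) @[z --> (nbhs t, nbhs y)] --> (0 : R).
  by rewrite -(subrr (h (seg y t))); exact: cvgB.
have /cvgr0_norm_lt/(_ _ e0) := c3; apply: filterS => -[t' z] //=.
Qed.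

Lemma ray_continuous h y (t : R) :
  (forall z, B z -> {for z, continuous h}) -> B y ->
  `[0, 1]%classic t -> {for t, continuous (fun s : R => h (seg y s))}.
Proof.
move=> ch By t01.
have chs : {for seg y t, continuous h} by apply: ch; exact: ball_seg.
have c0 : seg y s @[s --> nbhs t] --> seg y t.
  apply: cvgD; first exact: cvg_cst.
  by apply: cvgZr_tmp; exact: cvg_id.
exact: (cvg_comp _ _ c0 chs).
Qed.

Lemma ray_within m h y : (forall z, B z -> {for z, continuous h}) -> B y ->
  {within `[(0 : R), 1], continuous (fun t => t ^+ m * h (seg y t))}.
Proof.
move=> ch By; apply: continuous_in_subspaceT => t /set_mem t01.
apply: cvgM; first exact: exprn_continuous.
exact: ray_continuous.
Qed.

Lemma ray_integrable m h y : (forall z, B z -> {for z, continuous h}) -> B y ->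
  mu.-integrable `[0, 1] (EFin \o (fun t => t ^+ m * h (seg y t))).
Proof.
move=> ch By; apply: continuous_compact_integrable;
  first exact: segment_compact.
exact: ray_within.
Qed.

Lemma lebesgue01 : fine (mu `[(0 : R), 1]%classic) = 1.
Proof. by rewrite lebesgue_measure_itv /= lte_fin ltr01 -EFinD /= subr0. Qed.

Lemma ball_near y : B y -> \forall z \near y, B z.
Proof. by move=> By; apply: (open_nbhs_nbhs (conj _ By)); exact: ball_open. Qed.

Lemma ray_mean_continuous m h y :
  (forall z, B z -> {for z, continuous h}) -> B y ->
  {for y, continuous (ray_mean m h)}.
Proof.
move=> ch By; apply/(@cvgrPdist_le _ _ _ (nbhs y)) => e e0.
apply: filterS2 (ball_near By) (ray_uniform ch By e0) => z Bz Hz.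
have i1 := ray_integrable m ch By; have i2 := ray_integrable m ch Bz.
rewrite /ray_mean -RintegralB //.
have i3 : mu.-integrable `[0, 1]
    (EFin \o (fun t => t ^+ m * h (seg y t) - t ^+ m * h (seg z t))).
  by apply: eq_integrable (integrableB _ i1 i2).
apply: le_trans (le_normr_Rintegral _ i3) _ => //.
apply: (@le_trans _ _ (\int[mu]_(t in `[0, 1]) e)).
  apply: le_Rintegral => //.
  - exact: integrable_norm.
  - apply: continuous_compact_integrable; first exact: segment_compact.
    by apply: continuous_subspaceT => ?; exact: cvg_cst.
  move=> t t01; rewrite -mulrBr normrM.
  apply: le_trans (ltW (Hz t t01)); rewrite ler_piMl // normrX exprn_ile1 //.
  by move: t01; rewrite /= in_itv /= => /andP[t0 t1]; rewrite ger0_norm.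
by rewrite Rintegral_cst // lebesgue01 mulr1.
Qed.

(** Differentiation under the integral sign; [ray_uniform], applied to the
    partial derivative, provides the dominating function. *)
Lemma ray_mean_is_derive m h y i :
  (forall z, B z -> Ck_at 1 h z) -> B y ->
  is_derive y (delta_mx 0 i) (ray_mean m h)
    (ray_mean m.+1 ('D_(delta_mx 0 i) h) y).
Proof.
set e := delta_mx 0 i => Ch By; pose k := 'D_e h.
have ch z : B z -> {for z, continuous h} by move=> /Ch/Ck_at_continuous.
have dh z : B z -> derivable h z e.
  by move=> /Ch[_ /(_ i)[/nbhs_singleton]].
have ck z : B z -> {for z, continuous k}.
  by move=> /Ch[_ /(_ i)[_ [/nbhs_singleton]]].
have line_cvg : (y + s *: e) @[s --> (0 : R)] --> y.
  rewrite -[X in _ --> X]addr0 -(scale0r e); apply: cvgD; first exact: cvg_cst.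
  by apply: cvgZr_tmp; exact: cvg_id.
have : \forall s \near (0 : R), B (y + s *: e) /\
    forall t : R, `[0, 1]%classic t ->
      `|k (seg y t) - k (seg (y + s *: e) t)| < 1.
  apply: filterI; first exact: line_cvg (ball_near By).
  exact: line_cvg (ray_uniform ck By ltr01).
move=> /nbhs_ballP[d /= d0 Hd].
have Hs (s : R) : `]- d, d[%classic s -> ball 0 d s.
  by rewrite /= in_itv /= -ball_normE /= sub0r normrN ltr_norml.
have segE s t : seg (y + s *: e) t = seg y t + (s * t) *: e.
  by rewrite addrAC scalerDr addrA scalerA [t * s]mulrC.
pose f (s t : R) := t ^+ m * h (seg (y + s *: e) t).
have I0 : `]- d, d[%classic (0 : R) by rewrite /= in_itv /= oppr_lt0 d0.
have df s t : `]- d, d[%classic s -> `[0, 1]%classic t ->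
    is_derive s 1 (f ^~ t) (t ^+ m * (t * k (seg (y + s *: e) t))).
  move=> sd t01; have [Bs _] := Hd s (Hs s sd).
  have d1 : is_derive s 1 (fun s => h (seg y t + (s * t) *: e))
      (t * 'D_e h (seg y t + (s * t) *: e)).
    by apply: is_derive_line; rewrite -segE; apply: dh; exact: ball_seg.
  rewrite segE.
  rewrite (_ : f ^~ t = (t ^+ m) \*: (fun s => h (seg y t + (s * t) *: e))).
    exact: is_deriveZ.
  by apply/funext => u; rewrite /f segE.
pose G (t : R) := `|k (seg y t)| + 1.
have intG : mu.-integrable `[0, 1] (EFin \o G).
  apply: continuous_compact_integrable; first exact: segment_compact.
  apply: continuous_in_subspaceT => t /set_mem t01; apply: cvgD;
    last exact: cvg_cst.
  by apply: cvg_norm; exact: (ray_continuous ck By t01).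
have intf s : `]- d, d[%classic s -> mu.-integrable `[0, 1] (EFin \o f s).
  by move=> /Hs/Hd[Bs _]; exact: ray_integrable ch Bs.
have G0 t : 0 <= G t by rewrite addr_ge0.
have dfb s t : `]- d, d[%classic s -> `[0, 1]%classic t ->
    `|partial1of2 f s t| <= G t.
  move=> sd t01; have [_ dE] := df s t sd t01; rewrite partial1of2E dE.
  have [_ /(_ t t01)] := Hd s (Hs s sd).
  move: (t01); rewrite /= in_itv /= => /andP[t0 t1] kk.
  rewrite !normrM normrX (ger0_norm t0).
  apply: (@le_trans _ _ `|k (seg (y + s *: e) t)|).
    rewrite mulrA ler_piMl // mulr_ile1 ?exprn_ge0 // exprn_ile1 //.
  rewrite -lerBlDl; apply: le_trans (lerB_dist _ _) _.
  by rewrite distrC ltW.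
have dvf s t : `]- d, d[%classic s -> `[0, 1]%classic t ->
    derivable (f ^~ t) s 1.
  by move=> sd t01; case: (df s t sd t01).
have mI : measurable (`[0, 1]%classic : set (measurableTypeR R)) by [].
have E1 :=
  @differentiation_under_integral R _ _ mu f _ mI 0 (- d) d I0 intf dvf G G0
    intG dfb.
have E2 :=
  @derivable_under_integral R _ _ mu f _ mI 0 (- d) d I0 intf dvf G G0 intG dfb.
have FE u :
    (fun u : R => u^-1 *:
      ((ray_mean m h \o shift y) (u *: e) - ray_mean m h y)) u =
    u^-1 *: (\int[mu]_(t in `[0, 1]) f (u *: 1 + 0) t -
             \int[mu]_(t in `[0, 1]) f 0 t).
  rewrite /= addr0 /ray_mean /f scale0r addr0; congr (_ *: (_ - _)).
  by apply: eq_Rintegral => t _; rewrite [_ *: e + y]addrC [u%:A]mulr1.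
apply: DeriveDef.
  rewrite /derivable (funext FE); exact: E2.
rewrite /derive (funext FE); move: E1; rewrite derive1E /derive => ->.
apply: eq_Rintegral => t /set_mem t01.
have [_ dE] := df 0 t I0 t01; rewrite partial1of2E dE.
by rewrite scale0r addr0 mulrA exprSr.
Qed.

Lemma ray_mean_Ck k m h : (forall z, B z -> forall l, Ck_at l h z) ->
  forall y, B y -> Ck_at k (ray_mean m h) y.
Proof.
elim: k m h => [|k IH] m h Ch y By; split => //.
- apply: filterS (ball_near By) => z Bz; apply: ray_mean_continuous Bz => u Bu.
  exact: Ck_at_continuous (Ch u Bu 0%N).
- apply: filterS (ball_near By) => z Bz; apply: ray_mean_continuous Bz => u Bu.
  exact: Ck_at_continuous (Ch u Bu 0%N).
move=> i; have D z : B z -> is_derive z (delta_mx 0 i) (ray_mean m h)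
    (ray_mean m.+1 ('D_(delta_mx 0 i) h) z).
  by move=> Bz; apply: ray_mean_is_derive => // u Bu; exact: Ch.
split; first by apply: filterS (ball_near By) => z /D[].
apply: (@Ck_at_near _ _ _ (ray_mean m.+1 ('D_(delta_mx 0 i) h))).
  by apply: filterS (ball_near By) => z /D[].
by apply: IH By => z Bz l; case: (Ch z Bz l.+1) => _ /(_ i)[].
Qed.

(** The derivative of [t |-> h (a + t (y - a))], integrated from 0 to 1. *)
Lemma ray_FTC h y : (forall z, B z -> Ck_at 1 h z) -> B y ->
  h y - h a = \sum_i (y - a) 0 i * ray_mean 0 ('D_(delta_mx 0 i) h) y.
Proof.
move=> Ch By.
have dh z : B z -> differentiable h z by move=> /Ch/C1_differentiable.
have ck i z : B z -> {for z, continuous ('D_(delta_mx 0 i) h)}.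
  by move=> /Ch[_ /(_ i)[_ [/nbhs_singleton]]].
pose v := y - a.
pose F (t : R) := h (seg y t).
pose dF (t : R) : R := \sum_i v 0 i * 'D_(delta_mx 0 i) h (seg y t).
have DF (t : R) : `[0, 1]%classic t -> is_derive t 1 F (dF t).
  move=> t01; have Bs := ball_seg By t01.
  have d1 : is_derive t 1 (fun s => h (a + (s * 1) *: v))
      (1 * 'D_v h (a + (t * 1) *: v)).
    by apply: is_derive_line; rewrite mulr1; apply: diff_derivable; exact: dh.
  rewrite (_ : F = (fun s => h (a + (s * 1) *: v)));
    last by apply/funext => s; rewrite mulr1.
  apply: is_derive_eq; rewrite mulr1 mul1r deriveE; last exact: dh.
  rewrite [X in 'd h _ X]row_sum_delta linear_sum; apply: eq_bigr => i _.
  by rewrite linearZ /= (deriveE _ (dh _ Bs)).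
have cdF i : {within `[(0:R), 1],
    continuous (fun t : R => 'D_(delta_mx 0 i) h (seg y t))}.
  by apply: continuous_in_subspaceT => t /set_mem t01;
    exact: (ray_continuous (ck i) By t01).
have cF : {within `[(0:R), 1], continuous dF}.
  apply: continuous_in_subspaceT => t /set_mem t01.
  apply: (@cvg_big R 'I_n +%R 0 predT (@add_continuous _) _ (nbhs t) _
    (fun i s => v 0 i * 'D_(delta_mx 0 i) h (seg y s))) => i _.
  apply: cvgM; first exact: cvg_cst.
  exact: (ray_continuous (ck i) By t01).
have in01 : `[(0:R), 1]%classic 0 /\ `[(0:R), 1]%classic 1.
  by rewrite /= !in_itv /= !lexx ler01.
have cont (t : R) : `[0, 1]%classic t -> F s @[s --> t] --> F t.
  by move=> /DF[/derivable1_diffP/differentiable_continuous].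
have LR : derivable_oo_LRcontinuous F 0 1.
  split.
  - move=> t; rewrite in_itv /= => /andP[t0 t1].
    by have [] := DF t; rewrite /= ?in_itv /= ?ltW.
  - by apply: cvg_at_right_filter; exact: cont in01.1.
  - by apply: cvg_at_left_filter; exact: cont in01.2.
have F'f : {in `]0, 1[, derive1 F =1 dF}.
  move=> t; rewrite in_itv /= => /andP[t0 t1]; rewrite derive1E.
  by have [] := DF t; rewrite /= ?in_itv /= ?ltW.
have := continuous_FTC2 ltr01 cF LR F'f.
move=> /(congr1 fine) /=.
rewrite /F scale0r addr0 scale1r [a + _]addrC subrK => <-.
rewrite -[LHS]/(\int[mu]_(t in `[0, 1]) dF t).
have int i : mu.-integrable `[0, 1]
    (EFin \o (fun t : R => 'D_(delta_mx 0 i) h (seg y t))).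
  by apply: continuous_compact_integrable => //; exact: segment_compact.
have mI : measurable (`[0, 1]%classic : set (measurableTypeR R)) by [].
have [_ ->] : mu.-integrable `[0, 1] (EFin \o dF) /\
    \int[mu]_(t in `[0, 1]) dF t =
    \sum_i v 0 i * \int[mu]_(t in `[0, 1]) 'D_(delta_mx 0 i) h (seg y t).
  rewrite /dF; elim: (index_enum _) => [|i s [IH1 IH2]].
    split; last by under eq_Rintegral do rewrite big_nil;
      rewrite Rintegral_cst // mul0r big_nil.
    apply: (@eq_integrable _ _ _ mu _ mI (EFin \o cst 0));
      first by move=> t _ /=; rewrite big_nil.
    by apply: continuous_compact_integrable; [exact: segment_compact|
      apply: continuous_subspaceT => ?; exact: cvg_cst].
  have iv : mu.-integrable `[0, 1]
      (EFin \o (fun t : R => v 0 i * 'D_(delta_mx 0 i) h (seg y t))).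
    exact: eq_integrable (integrableZl mI (v 0 i) (int i)).
  split.
    apply: eq_integrable (integrableD mI iv IH1) => //.
    by move=> t _ /=; rewrite big_cons.
  rewrite big_cons -IH2 -RintegralZl // -RintegralD //.
  by apply: eq_Rintegral => t _; rewrite big_cons.
by apply: eq_bigr => i _; congr (_ * _); apply: eq_Rintegral => t _;
  rewrite expr0 mul1r.
Qed.

Lemma hadamard f : 0 < r -> (forall z, B z -> forall l, Ck_at l f z) ->
  exists g : 'I_n -> 'rV[R]_n -> R,
    (forall i z, B z -> forall l, Ck_at l (g i) z) /\
    forall y, B y -> f y = f a + \sum_i (y 0 i - a 0 i) * g i y.
Proof.
move=> r0 Cf; exists (fun i => ray_mean 0 ('D_(delta_mx 0 i) f)); split.
  move=> i z Bz l; apply: ray_mean_Ck Bz => u Bu k.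
  by case: (Cf u Bu k.+1) => _ /(_ i)[].
move=> y By; apply/eqP; rewrite -subr_eq0 opprD addrA ray_FTC //.
  by under eq_bigr do rewrite !mxE; rewrite subrr.
by move=> z Bz; exact: Cf.
Qed.

End hadamard.

(** * Smoothness in charts *)

Arguments cinv {R M} c _ : rename.

Section charted_theory.
Variable R : realType.

(** The part of the manifold structure on which local arguments depend. It is
    separated from the Hausdorff and countability conditions so that it can be
    established for a product, which comes only as a space with an atlas. *)
Record compatible (C : charted R) : Prop := Compatible {
  compat_charts : forall c : chart R C, atlas c -> is_chart c;
  compat_cover : forall x : C, exists2 c : chart R C, atlas c & cdom c x;
  compat_trans : forall c d : chart R C, atlas c -> atlas d ->
    forall x, cdom c x -> cdom d x ->
    forall (i : 'I_(cdim d)) k,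
      Ck_at k (fun v => cmap d (cinv c v) 0 i) (cmap c x) }.

Lemma manifold_compatible (M : manifold R) : compatible M.
Proof. split; [exact: mcharts|exact: mcover|exact: mtrans]. Qed.

Section one_space.
Variable C : charted R.
Hypothesis HC : compatible C.
Implicit Types (c d : chart R C) (x y : C) (f : C -> R).

Lemma near_cdom c x : atlas c -> cdom c x -> \forall y \near x, cdom c y.
Proof.
by move=> /(compat_charts HC) [dop _ _ _ _] cx; apply: open_nbhs_nbhs.
Qed.

Lemma smooth_at_near x f g : {near x, f =1 g} -> smooth_at x f -> smooth_at x g.
Proof.
move=> /near_join fg sf; near=> y => c ac cy k.
have fy : forall k, Ck_at k (f \o cinv c) (cmap c y).
  by move: c ac cy {k}; near: y.
apply: Ck_at_near (fy k).
have [_ _ ci _ cc] := compat_charts HC ac.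
have fgy : \forall z \near y, f z = g z by near: y.
have := cc _ cy; rewrite /prop_for /continuous_at ci // => /(_ _ fgy).
exact.
Unshelve. all: by end_near. Qed.

Lemma smooth_in_chart c x f : atlas c -> cdom c x -> smooth_at x f ->
  \forall v \near cmap c x, forall k, Ck_at k (f \o cinv c) v.
Proof.
move=> ac cx sf; have [dop oi ci _ cc] := compat_charts HC ac.
have nimg : \forall v \near cmap c x, (cmap c @` cdom c) v.
  by apply: open_nbhs_nbhs; split => //; exists x.
have nf : \forall v \near cmap c x, forall d, atlas d -> cdom d (cinv c v) ->
    forall k, Ck_at k (f \o cinv d) (cmap d (cinv c v)).
  have := cc _ cx; rewrite /prop_for /continuous_at ci // => /(_ _ sf).
  exact.
apply: filterS2 nimg nf => _ [y cy <-]; rewrite ci // => Hy k.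
exact: Hy.
Qed.

(** Smoothness in one chart suffices: in another one the function is composed
    with a transition map. *)
Lemma smooth_of_chart c x (g : 'rV[R]_(cdim c) -> R) : atlas c -> cdom c x ->
  (\forall v \near cmap c x, forall k, Ck_at k g v) ->
  smooth_at x (g \o cmap c).
Proof.
move=> ac cx /near_join sg; have [dop oi ci cm cc] := compat_charts HC ac.
have nc := near_cdom ac cx.
have ng : \forall y \near x, \forall v \near cmap c y, forall k, Ck_at k g v.
  exact: (cm _ cx _ sg).
near=> y => d ad dy k.
have [_ _ di _ _] := compat_charts HC ad.
have cy : cdom c y by near: y.
have gy : \forall v \near cmap c y, forall k, Ck_at k g v by near: y.
apply: (@Ck_at_comp R _ _ k g (cmap c \o cinv d)) => [j|].
  exact: (compat_trans HC ad ac dy cy).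
by rewrite /= di //; exact: (nbhs_singleton gy).
Unshelve. all: by end_near. Qed.

Lemma chart_coord_smooth c x i : atlas c -> cdom c x ->
  smooth_at x (fun y => cmap c y 0 i).
Proof.
move=> ac cx; apply: (smooth_of_chart (g := fun v => v 0 i) ac cx).
by near=> v => k; exact: Ck_at_coord.
Unshelve. all: by end_near. Qed.

Lemma smooth_continuous x f : smooth_at x f -> {for x, continuous f}.
Proof.
move=> sf; have [c ac cx] := compat_cover HC x.
have [_ _ ci cm cc] := compat_charts HC ac.
have /Ck_at_continuous cf := nbhs_singleton (smooth_in_chart ac cx sf) 0%N.
have cfx : {for x, continuous ((f \o cinv c) \o cmap c)}.
  exact: continuous_comp (cm _ cx) cf.
rewrite /prop_for /continuous_at /= ci // in cfx.
apply: cvg_trans cfx; apply: near_eq_cvg.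
by apply: filterS (near_cdom ac cx) => y cy; rewrite /= ci.
Qed.

Lemma smooth_atV x f : f x != 0 -> smooth_at x f ->
  smooth_at x (fun y => (f y)^-1).
Proof.
move=> f0 sf; have nf : \forall y \near x, f y != 0.
  exact: cvgr_neq0 (smooth_continuous sf) f0.
near=> y => c ac cy k.
apply: (@Ck_atV R _ k (f \o cinv c)).
  by rewrite /= cmapK //; [near: y|exact: compat_charts].
by move: c ac cy k; near: y.
Unshelve. all: by end_near. Qed.

End one_space.

Lemma smooth_at_sum (C : charted R) (x : C) (I : Type) (r : seq I) (P : pred I)
    (F : I -> C -> R) :
  (forall i, P i -> smooth_at x (F i)) -> smooth_at x (\sum_(i <- r | P i) F i).
Proof.
move=> H; apply: (big_ind (smooth_at x)) => //;
  first exact: (smooth_at_cst x 0).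
by move=> f g; exact: smooth_atD.
Qed.

Lemma smooth_at_prod (C : charted R) (x : C) (I : Type) (r : seq I)
    (F : I -> C -> R) :
  (forall i, smooth_at x (F i)) -> smooth_at x (fun y => \prod_(i <- r) F i y).
Proof.
move=> H; elim: r => [|i r IH].
  by under eq_fun do rewrite big_nil; exact: (smooth_at_cst x 1).
by under eq_fun do rewrite big_cons; exact: (smooth_atM (H i) IH).
Qed.

Lemma smooth_at_det (C : charted R) (x : C) n (A : C -> 'M[R]_n) :
  (forall i j, smooth_at x (fun y => A y i j)) ->
  smooth_at x (fun y => \det (A y)).
Proof.
move=> sA; rewrite (_ : (fun y => _) = \sum_(s : 'S_n)
    ((cst ((-1) ^+ s) : C -> R) * (fun y => \prod_i A y i (s i)))).
  apply: smooth_at_sum => s _; apply: smooth_atM; first exact: smooth_at_cst.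
  by apply: smooth_at_prod => i; exact: sA.
by apply/funext => y; rewrite fct_sumE.
Qed.

(** Cramer's rule. *)
Lemma smooth_at_invmx (C : charted R) (HC : compatible C) (x : C) n
    (A : C -> 'M[R]_n) i j :
  (forall i j, smooth_at x (fun y => A y i j)) -> A x \in unitmx ->
  smooth_at x (fun y => invmx (A y) i j).
Proof.
move=> sA; rewrite unitmxE unitfE => dA.
have sdet := smooth_at_det sA.
have nd : \forall y \near x, \det (A y) != 0.
  exact: cvgr_neq0 (smooth_continuous HC sdet) dA.
apply: (@smooth_at_near _ HC _ ((fun y => (\det (A y))^-1) *
    ((cst ((-1) ^+ (j + i)) : C -> R) *
     (fun y => \det (row' j (col' i (A y))))))).
  apply: filterS nd => y dy; rewrite /invmx unitmxE unitfE dy !mxE.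
  by rewrite /cofactor.
apply: smooth_atM; first exact: smooth_atV.
apply: smooth_atM; first exact: smooth_at_cst.
apply: smooth_at_det => k l.
rewrite (_ : (fun y => _) = fun y => A y (lift j k) (lift i l)).
  exact: sA.
by apply/funext => y; rewrite !mxE.
Qed.

End charted_theory.

(** * Tangent vectors in coordinates *)

Section tangent_vectors.
Variables (R : realType) (C : charted R).
Implicit Types (x : C) (f g : C -> R).

Lemma tangent_addE x (u v : tangent x) f : (u + v) f = u f + v f.
Proof. by []. Qed.

Lemma tangent_scaleE x (r : R) (v : tangent x) f : (r *: v) f = r * v f.
Proof. by []. Qed.

Lemma tangent_zeroE x f : (0 : tangent x) f = 0.
Proof. by []. Qed.

Lemma tangent_oppE x (v : tangent x) f : (- v) f = - v f.
Proof. by []. Qed.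

Lemma tangent_sumE x (I : Type) (r : seq I) (P : pred I)
    (F : I -> tangent x) f :
  (\sum_(i <- r | P i) F i) f = \sum_(i <- r | P i) F i f.
Proof. by elim/big_rec2: _ => // i y1 y2 _ <-. Qed.

Lemma tangent_ext x (u v : tangent x) :
  (forall f, smooth_at x f -> u f = v f) -> u = v.
Proof.
move=> uv; apply: val_inj; apply/funext => f.
have [u0 _ _ _] := tangentP u; have [v0 _ _ _] := tangentP v.
by have [sf|nf] := pselect (smooth_at x f);
  [exact: uv|rewrite [LHS]u0 // [RHS]v0].
Qed.

Lemma tangent_near x (v : tangent x) f g : smooth_at x f -> smooth_at x g ->
  {near x, f =1 g} -> v f = v g.
Proof. by have [_ + _ _] := tangentP v; exact. Qed.

Lemma tangent0 x (v : tangent x) : v 0 = 0.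
Proof.
have [_ _ l _] := tangentP v; have s0 := smooth_at_cst x (0 : R).
have := l 1 0 0 s0 s0; rewrite scaler0 addr0 mul1r => /eqP.
by rewrite -subr_eq subrr eq_sym => /eqP.
Qed.

Lemma tangentD x (v : tangent x) f g : smooth_at x f -> smooth_at x g ->
  v (f + g) = v f + v g.
Proof.
by move=> sf sg; have [_ _ l _] := tangentP v;
  rewrite -[f]scale1r l // mul1r scale1r.
Qed.

Lemma tangentZ x (v : tangent x) (r : R) f : smooth_at x f ->
  v (r *: f) = r * v f.
Proof.
move=> sf; have [_ _ l _] := tangentP v.
by rewrite -[r *: f]addr0 l ?tangent0 ?addr0 //; exact: (smooth_at_cst x 0).
Qed.

Lemma tangentM x (v : tangent x) f g : smooth_at x f -> smooth_at x g ->
  v (f * g) = f x * v g + g x * v f.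
Proof. by have [_ _ _] := tangentP v; exact. Qed.

(** Apply the Leibniz rule to [1 * 1]. *)
Lemma tangent_cst x (v : tangent x) (r : R) : v (cst r) = 0.
Proof.
have s1 := smooth_at_cst x (1 : R).
have v1 : v (cst 1) = 0.
  have := tangentM v s1 s1.
  rewrite (_ : cst 1 * cst 1 = cst 1); last by apply/funext => y; exact: mulr1.
  by rewrite mul1r => /eqP; rewrite -subr_eq subrr eq_sym => /eqP.
rewrite (_ : cst r = r *: cst 1).
  by rewrite tangentZ // v1 mulr0.
by apply/funext => y; exact: esym (mulr1 _).
Qed.

Lemma tangent_sum x (v : tangent x) (I : Type) (r : seq I) (F : I -> C -> R) :
  (forall i, smooth_at x (F i)) ->
  v (\sum_(i <- r) F i) = \sum_(i <- r) v (F i).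
Proof.
move=> sF; elim: r => [|i r IH]; first by rewrite !big_nil tangent0.
by rewrite !big_cons tangentD ?IH //; exact: smooth_at_sum.
Qed.

Lemma smooth_field_near_id (xi : field C) x :
  smooth_field_at xi x -> \forall y \near x, smooth_field_at xi y.
Proof. exact: near_join. Qed.

Lemma smooth_field_comb x n (b : 'I_n -> C -> R) (xi : 'I_n -> field C) :
  (forall j, smooth_at x (b j)) -> (forall j, smooth_field_at (xi j) x) ->
  smooth_field_at (fun y => \sum_j b j y *: xi j y) x.
Proof.
move=> sb sxi.
have nb : \forall y \near x, forall j, smooth_at y (b j).
  by apply: (@filter_forall _ _ _ (nbhs x)) => j; exact: smooth_at_join.
have nx : \forall y \near x, forall j, smooth_field_at (xi j) y.
  by apply: (@filter_forall _ _ _ (nbhs x)) => j; exact: smooth_field_near_id.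
apply: filterS2 nb nx => y by_ xy f sf.
rewrite (_ : (fun z => _) = \sum_j (b j * (fun z => xi j z f))).
  by apply: smooth_at_sum => j _; apply: smooth_atM => //;
    exact: smooth_field_app.
by apply/funext => z; rewrite fct_sumE tangent_sumE.
Qed.

Hypothesis HC : compatible C.

Lemma smooth_field_at_near (xi eta : field C) x :
  (\forall y \near x, xi y = eta y) -> smooth_field_at xi x ->
  smooth_field_at eta x.
Proof.
move=> /near_join e s; apply: filterS2 e s => y ey sy f sf.
apply: smooth_at_near (sy _ sf) => //.
by apply: filterS ey => z ->.
Qed.

(** By Hadamard's lemma a smooth [f] is, near [x], the constant [f x] plus a sum
    of products [u_i * g_i] where [u_i] is a coordinate centred at [x]; the
    derivation sees such a product only through its value on [u_i]. *)
Lemma tangent_chart_eq0 (c : chart R C) x (v : tangent x) :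
  atlas c -> cdom c x ->
  (forall i, v (fun y => cmap c y 0 i) = 0) -> v = 0.
Proof.
move=> ac cx v0; apply: tangent_ext => f sf; rewrite tangent_zeroE.
have [_ _ ci cm _] := compat_charts HC ac.
have /nbhs_ballP[r /= r0 Br] := smooth_in_chart HC ac cx sf.
have [g [sg Eg]] := hadamard r0 Br.
have nB : \forall y \near x, ball (cmap c x) r (cmap c y).
  by apply: (cm _ cx); exact: nbhsx_ballx.
pose u i : C -> R := (fun y => cmap c y 0 i) + cst (- cmap c x 0 i).
have su i : smooth_at x (u i).
  by apply: smooth_atD; [exact: chart_coord_smooth|exact: smooth_at_cst].
have sgi i : smooth_at x (g i \o cmap c).
  apply: smooth_of_chart => //.
  by apply: filterS (nbhsx_ballx _ _ r0) => w Bw l; exact: sg.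
have -> : v f = v (cst (f x) + \sum_i u i * (g i \o cmap c)).
  apply: tangent_near => //.
    apply: smooth_atD; first exact: smooth_at_cst.
    by apply: smooth_at_sum => i _; exact: smooth_atM.
  apply: filterS2 nB (near_cdom HC ac cx) => y By cy.
  have := Eg _ By; rewrite /= !ci // => ->.
  rewrite -[RHS]/(f x + (\sum_i u i * (g i \o cmap c)) y) fct_sumE;
    congr (_ + _).
rewrite tangentD; [|exact: smooth_at_cst|].
  rewrite tangent_cst add0r tangent_sum; last by move=> i; exact: smooth_atM.
  apply: big1 => i _; rewrite tangentM // [u i x]subrr mul0r add0r.
  rewrite tangentD ?v0 ?tangent_cst ?addr0 ?mulr0 //.
    exact: chart_coord_smooth.
  exact: smooth_at_cst.
by apply: smooth_at_sum => i _; exact: smooth_atM.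
Qed.

(** The coordinate field of [c] in direction [i], of interest on [cdom c]. *)
Definition chart_field (c : chart R C) (i : 'I_(cdim c)) : field C := fun y =>
  mk_tangent y (fun f => 'D_(delta_mx 0 i) (f \o cinv c) (cmap c y)).

Lemma chart_fieldE (c : chart R C) (i : 'I_(cdim c)) y f :
  atlas c -> cdom c y -> smooth_at y f ->
  chart_field i y f = 'D_(delta_mx 0 i) (f \o cinv c) (cmap c y).
Proof.
move=> ac cy; have [_ _ ci _ cc] := compat_charts HC ac.
have D h : smooth_at y h -> derivable (h \o cinv c) (cmap c y) (delta_mx 0 i).
  move=> sh; have := nbhs_singleton (smooth_in_chart HC ac cy sh) 1%N.
  by case=> _ /(_ i)[/nbhs_singleton].
apply: mk_tangentE => [g h sg sh gh|r g h sg sh|g h sg sh].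
- apply: near_eq_derive.
  have := cc _ cy; rewrite /prop_for /continuous_at ci // => /(_ _ gh).
  exact.
- have [dg dh] := (D _ sg, D _ sh).
  rewrite -[_ \o _]/(r *: (g \o cinv c) + (h \o cinv c)) deriveD //.
    by rewrite deriveZ.
  exact: derivableZ.
- have [dg dh] := (D _ sg, D _ sh).
  rewrite -[_ \o _]/((g \o cinv c) * (h \o cinv c)) deriveM //.
  by rewrite /= !ci.
Qed.

Lemma chart_field_coord (c : chart R C) (i j : 'I_(cdim c)) y :
  atlas c -> cdom c y ->
  chart_field i y (fun z => cmap c z 0 j) = (i == j)%:R.
Proof.
move=> ac cy; rewrite chart_fieldE //; last exact: chart_coord_smooth.
have [_ oi ci _ _] := compat_charts HC ac.
have [_ <-] := is_derive_coord i j (cmap c y).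
apply: near_eq_derive.
have nimg : \forall v \near cmap c y, (cmap c @` cdom c) v.
  by apply: open_nbhs_nbhs; split => //; exists y.
by apply: filterS nimg => _ [z cz <-] /=; rewrite ci.
Qed.

Lemma chart_field_smooth (c : chart R C) (i : 'I_(cdim c)) x :
  atlas c -> cdom c x ->
  smooth_field_at (chart_field i) x.
Proof.
move=> ac cx; apply: filterS (near_cdom HC ac cx) => y cy f sf.
apply: (@smooth_at_near _ _ HC _ ('D_(delta_mx 0 i) (f \o cinv c) \o cmap c)).
  apply: filterS2 (near_cdom HC ac cy) (smooth_at_join sf) => z cz sz.
  by rewrite chart_fieldE.
apply: smooth_of_chart => //;
  apply: filterS (smooth_in_chart HC ac cy sf) => w Cw k.
by case: (Cw k.+1) => _ /(_ i)[].
Qed.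

Lemma tangent_chartE (c : chart R C) x (v : tangent x) : atlas c -> cdom c x ->
  v = \sum_i v (fun y => cmap c y 0 i) *: chart_field i x.
Proof.
move=> ac cx; apply/eqP; rewrite -subr_eq0; apply/eqP.
apply: (tangent_chart_eq0 ac cx) => j.
rewrite tangent_addE tangent_oppE tangent_sumE (bigD1 j) // big1 => [|i ij].
  rewrite tangent_scaleE chart_field_coord // eqxx mulr1.
  by rewrite [X in _ - X]addr0 subrr.
by rewrite [LHS]tangent_scaleE chart_field_coord // (negbTE ij) mulr0.
Qed.

(** Extend by constant coefficients in the coordinate fields of a chart. *)
Lemma tangent_extend x (v : tangent x) :
  exists xi : field C, smooth_field_at xi x /\ xi x = v.
Proof.
have [c ac cx] := compat_cover HC x.
exists (fun y => \sum_i cst (v (fun z => cmap c z 0 i)) y *: chart_field i y).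
split.
  apply: smooth_field_comb => i; first exact: smooth_at_cst.
  exact: chart_field_smooth.
by rewrite [RHS](tangent_chartE _ ac cx).
Qed.

End tangent_vectors.

(** * Products *)

Section products.
Variable R : realType.

Lemma smooth_map_comp (C D E : charted R) (f : C -> D) (g : D -> E) x :
  smooth_map_at f x -> smooth_map_at g (f x) -> smooth_map_at (g \o f) x.
Proof.
move=> [cf sf] [cg sg]; split; first exact: continuous_comp.
by move=> h sh; exact: sf (sg _ sh).
Qed.

Variables C D : charted R.
Hypotheses (HC : compatible C) (HD : compatible D).
Local Notation CD := (prod_charted C D).

Lemma prod_is_chart (c : chart R C) (d : chart R D) :
  is_chart c -> is_chart d -> is_chart (prod_chart c d).
Proof.
move=> [co cio ci cm cc] [do_ dio di dm dc].
have lc : continuous (fun v : 'rV[R]_(cdim c + cdim d) => lsubmx v).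
  move=> v; apply: rV_continuous => j.
  rewrite (_ : (fun w => _) = fun w : 'rV[R]_(cdim c + cdim d) =>
    w 0 (lshift _ j)).
    exact: coord_continuous.
  by apply/funext => w; rewrite mxE.
have rc : continuous (fun v : 'rV[R]_(cdim c + cdim d) => rsubmx v).
  move=> v; apply: rV_continuous => j.
  rewrite (_ : (fun w => _) = fun w : 'rV[R]_(cdim c + cdim d) =>
    w 0 (rshift _ j)).
    exact: coord_continuous.
  by apply/funext => w; rewrite mxE.
split.
- rewrite (_ : cdom _ = fst @^-1` cdom c `&` snd @^-1` cdom d).
    by apply: openI; apply: open_comp => // z _;
      [exact: cvg_fst|exact: cvg_snd].
  by apply/seteqP; split => [[x y]|[x y]].
- rewrite (_ : _ @` _ = (fun v => lsubmx v) @^-1` (cmap c @` cdom c) `&`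
      (fun v => rsubmx v) @^-1` (cmap d @` cdom d)).
    by apply: openI; apply: open_comp.
  apply/seteqP; split => [_ [[x y] [/= cx dy] <-]|v [[x cx xv] [y dy yv]]].
    by split; rewrite /= ?row_mxKl ?row_mxKr; [exists x|exists y].
  by exists (x, y) => //=; rewrite xv yv hsubmxK.
- by move=> [x y] [/= cx dy]; rewrite row_mxKl row_mxKr ci // di.
- move=> [x y] [/= cx dy]; apply: rV_continuous => j.
  case: (splitP j) => k jk.
    have -> : j = lshift _ k by apply: val_inj.
    rewrite (_ : (fun w => _) = fun w : C * D => cmap c w.1 0 k).
      apply: (@continuous_comp _ _ _ (fun w : C * D => cmap c w.1)
        (fun v => v 0 k)).
        by apply: (@continuous_comp _ _ _ fst (cmap c));
          [exact: cvg_fst|exact: cm].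
      exact: coord_continuous.
    by apply/funext => w /=; rewrite row_mxEl.
  have -> : j = rshift _ k by apply: val_inj.
  rewrite (_ : (fun w => _) = fun w : C * D => cmap d w.2 0 k).
    apply: (@continuous_comp _ _ _ (fun w : C * D => cmap d w.2)
      (fun v => v 0 k)).
      by apply: (@continuous_comp _ _ _ snd (cmap d));
        [exact: cvg_snd|exact: dm].
    exact: coord_continuous.
  by apply/funext => w /=; rewrite row_mxEr.
- move=> [x y] [/= cx dy]; set a := row_mx _ _.
  have h1 : {for a, continuous (fun v => cinv c (lsubmx v))}.
    apply: (@continuous_comp _ _ _ (fun v => lsubmx v) (cinv c));
      first exact: lc.
    by rewrite row_mxKl; exact: cc.
  have h2 : {for a, continuous (fun v => cinv d (rsubmx v))}.
    apply: (@continuous_comp _ _ _ (fun v => rsubmx v) (cinv d));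
      first exact: rc.
    by rewrite row_mxKr; exact: dc.
  exact: cvg_pair h1 h2.
Qed.

Lemma Ck_at_lsubmx m n k (f : 'rV[R]_m -> R) (a : 'rV[R]_(m + n)) :
  Ck_at k f (lsubmx a) -> Ck_at k (fun v => f (lsubmx v)) a.
Proof.
move=> Hf; apply: (@Ck_at_comp R _ _ k f (fun v => lsubmx v)) => // j.
rewrite (_ : (fun w => _) = fun w : 'rV[R]_(m + n) => w 0 (lshift _ j)).
  exact: Ck_at_coord.
by apply/funext => w; rewrite mxE.
Qed.

Lemma Ck_at_rsubmx m n k (f : 'rV[R]_n -> R) (a : 'rV[R]_(m + n)) :
  Ck_at k f (rsubmx a) -> Ck_at k (fun v => f (rsubmx v)) a.
Proof.
move=> Hf; apply: (@Ck_at_comp R _ _ k f (fun v => rsubmx v)) => // j.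
rewrite (_ : (fun w => _) = fun w : 'rV[R]_(m + n) => w 0 (rshift _ j)).
  exact: Ck_at_coord.
by apply/funext => w; rewrite mxE.
Qed.

Lemma prod_compatible : compatible CD.
Proof.
split.
- move=> _ [c [d [ac ad ->]]]; apply: prod_is_chart; exact: compat_charts.
- move=> [x y]; have [c ac cx] := compat_cover HC x.
  have [d ad dy] := compat_cover HD y.
  by exists (prod_chart c d) => //; exists c, d.
- move=> _ _ [c [d [ac ad ->]]] [c' [d' [ac' ad' ->]]].
  move=> [x y] [/= cx dy] [/= cx' dy'] i k.
  case: (splitP i) => j ij.
    have -> : i = lshift _ j by apply: val_inj.
    rewrite (_ : (fun v => _) = fun v : 'rV_(cdim c + cdim d) =>
      cmap c' (cinv c (lsubmx v)) 0 j).
      apply: (@Ck_at_lsubmx _ _ k (fun v => cmap c' (cinv c v) 0 j)).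
      by rewrite row_mxKl; exact: (compat_trans HC).
    by apply/funext => v; rewrite row_mxEl.
  have -> : i = rshift _ j by apply: val_inj.
  rewrite (_ : (fun v => _) = fun v : 'rV_(cdim c + cdim d) =>
    cmap d' (cinv d (rsubmx v)) 0 j).
    apply: (@Ck_at_rsubmx _ _ k (fun v => cmap d' (cinv d v) 0 j)).
    by rewrite row_mxKr; exact: (compat_trans HD).
  by apply/funext => v; rewrite row_mxEr.
Qed.

Lemma fst_smooth (z : CD) : @smooth_map_at R CD C fst z.
Proof.
split; first exact: cvg_fst.
move=> f sf; have : \forall y \near z, forall c, atlas c -> cdom c y.1 ->
    forall k, Ck_at k (f \o cinv c) (cmap c y.1) by exact: (cvg_fst sf).
apply: filterS => -[x y] /= H _ [c [d [ac ad ->]]] [/= cx dy] k.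
apply: (@Ck_at_lsubmx _ _ k (f \o cinv c)).
by rewrite row_mxKl; exact: H.
Qed.

Lemma snd_smooth (z : CD) : @smooth_map_at R CD D snd z.
Proof.
split; first exact: cvg_snd.
move=> f sf; have : \forall y \near z, forall c, atlas c -> cdom c y.2 ->
    forall k, Ck_at k (f \o cinv c) (cmap c y.2) by exact: (cvg_snd sf).
apply: filterS => -[x y] /= H _ [c [d [ac ad ->]]] [/= cx dy] k.
apply: (@Ck_at_rsubmx _ _ k (f \o cinv d)).
by rewrite row_mxKr; exact: H.
Qed.

Lemma slice_smooth (x : C) (y : D) : @smooth_map_at R D CD (pair x) y.
Proof.
have cp : {for y, continuous (pair x : D -> C * D)}.
  by apply: cvg_pair; [exact: cvg_cst|exact: cvg_id].
split => // f sf.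
have nf : \forall w \near y, forall e : chart R CD, atlas e -> cdom e (x, w) ->
    forall k, Ck_at k (f \o cinv e) (cmap e (x, w)) by exact: cp _ sf.
apply: filterS nf => w H d ad dw k.
have [c ac cx] := compat_cover HC x.
have [_ _ ci _ _] := compat_charts HC ac.
have {}H := H (prod_chart c d) _ _ k.
have := @Ck_at_comp R _ _ k (f \o cinv (prod_chart c d))
   (fun v : 'rV[R]_(cdim d) => row_mx (cmap c x) v) (cmap d w) _ _.
rewrite (_ : _ \o _ = (f \o pair x) \o cinv d); last first.
  by apply/funext => v; rewrite /= row_mxKl row_mxKr ci.
apply; last by apply: H; [exists c, d|].
move=> j; case: (splitP j) => i ij.
  have -> : j = lshift _ i by apply: val_inj.
  rewrite (_ : (fun v => _) = cst (cmap c x 0 i)); first exact: Ck_at_cst.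
  by apply/funext => v; rewrite row_mxEl.
have -> : j = rshift _ i by apply: val_inj.
rewrite (_ : (fun v => _) = fun v : 'rV[R]_(cdim d) => v 0 i);
  first exact: Ck_at_coord.
by apply/funext => v; rewrite row_mxEr.
Qed.

(** The coordinates of a product chart are pulled back from the factors. *)
Lemma tangent_prod_eq0 (z : CD) (v : tangent z) :
  (forall f : C -> R, smooth_at z.1 f -> v (f \o fst) = 0) ->
  (forall f : D -> R, smooth_at z.2 f -> v (f \o snd) = 0) -> v = 0.
Proof.
move=> v1 v2; have [c ac cx] := compat_cover HC z.1.
have [d ad dy] := compat_cover HD z.2.
apply: (@tangent_chart_eq0 _ _ prod_compatible (prod_chart c d)) => //.
  by exists c, d.
move=> j; case: (splitP j) => i ij.
  have -> : j = lshift _ i by apply: val_inj.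
  rewrite (_ : (fun y => _) = (fun w => cmap c w 0 i) \o fst).
    by apply: v1; exact: chart_coord_smooth.
  by apply/funext => w; rewrite /= row_mxEl.
have -> : j = rshift _ i by apply: val_inj.
rewrite (_ : (fun y => _) = (fun w => cmap d w 0 i) \o snd).
  by apply: v2; exact: chart_coord_smooth.
by apply/funext => w; rewrite /= row_mxEr.
Qed.

End products.

(** * Brackets *)

Section smooth_fields.
Variables (R : realType) (C : charted R).

Lemma smooth_fieldB (xi eta : field C) x :
  smooth_field_at xi x -> smooth_field_at eta x ->
  smooth_field_at (fun y => xi y - eta y) x.
Proof.
move=> sx se; apply: filterS2 sx se => y {}sx {}se f sf.
rewrite (_ : (fun z => _) = (fun z => xi z f) + (-1 : R) *: (fun z => eta z f)).
  by apply: smooth_atD; [exact: sx|apply: smooth_atZ; exact: se].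
by apply/funext => z; rewrite -[RHS]/(xi z f + -1 * eta z f) mulN1r.
Qed.

(** Near [x] each of the two fields sends [f o q] to 0, and the other one kills
    constants. *)
Lemma bracket_kill (T : charted R) (q : C -> T) (xi eta : field C) x
    (f : T -> R) :
  smooth_field_at xi x -> smooth_field_at eta x -> smooth_at x (f \o q) ->
  (\forall y \near x, xi y (f \o q) = 0) ->
  (\forall y \near x, eta y (f \o q) = 0) ->
  bracket xi eta x (f \o q) = 0.
Proof.
move=> sx se sf x0 e0; rewrite bracketE //.
rewrite (@tangent_near _ _ _ (xi x) _ (cst 0)) ?tangent_cst //; first last.
- exact: smooth_at_cst.
- exact: smooth_field_app.
rewrite (@tangent_near _ _ _ (eta x) _ (cst 0)) ?tangent_cst ?subrr //.
- exact: smooth_field_app.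
- exact: smooth_at_cst.
Qed.

End smooth_fields.

(** * Fundamental fields and the isotropy representation *)

Section g_manifold.
Variables (R : realType) (g : lieAlgebra R).

Section zeta.
Variable M : gmanifold g.
Let HM := manifold_compatible M.

Lemma zeta0 (x : M) : zeta 0 x = 0.
Proof.
have := zeta_linear (-1) 0 0 x; rewrite scaler0 addr0 scaleN1r => ->.
by rewrite addNr.
Qed.

Lemma zetaZ (r : R) X (x : M) : zeta (r *: X) x = r *: zeta X x.
Proof. by rewrite -[r *: X]addr0 zeta_linear zeta0 addr0. Qed.

Lemma zetaD X Y (x : M) : zeta (X + Y) x = zeta X x + zeta Y x.
Proof. by rewrite -[X]scale1r zeta_linear !scale1r. Qed.

Lemma zeta_sum n (b : 'I_n -> R) (X : 'I_n -> g) (x : M) :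
  zeta (\sum_j b j *: X j) x = \sum_j b j *: zeta (X j) x.
Proof.
elim: (index_enum _) => [|j s IH]; first by rewrite !big_nil zeta0.
by rewrite !big_cons zeta_linear IH.
Qed.

Lemma isotropy_rep_ext (x : M) X (v : tangent x) : isotropy x X ->
  exists xi : field M, [/\ smooth_field_at xi x, xi x = v &
    isotropy_rep X v = bracket (zeta X) xi x].
Proof.
move=> X0; have [xi [sxi <-]] := tangent_extend HM v.
by exists xi; split => //; exact: isotropy_repE.
Qed.

(** The right-hand side is a derivation of germs only because [zeta_X] vanishes
    at [x]; extending [v] to a field identifies it with a bracket. *)
Lemma isotropy_rep_app (x : M) X (v : tangent x) f : isotropy x X ->
  smooth_at x f -> isotropy_rep X v f = - v (fun y => zeta X y f).
Proof.
move=> X0 sf; have [xi [sxi <- ->]] := isotropy_rep_ext v X0.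
by rewrite bracketE // ?X0 ?tangent_zeroE ?sub0r //; exact: zeta_smooth.
Qed.

Lemma isotropy_nullP (x : M) (v : tangent x) : isotropy_null x v <->
  forall X f, isotropy x X -> smooth_at x f -> v (fun y => zeta X y f) = 0.
Proof.
split=> [H X f X0 sf|H X X0].
  apply/eqP; rewrite -oppr_eq0 -(isotropy_rep_app _ X0) // H //.
apply: tangent_ext => f sf.
by rewrite isotropy_rep_app // H // oppr0.
Qed.

Lemma isotropy_null_comb (x : M) (r : R) (u v : tangent x) :
  isotropy_null x u -> isotropy_null x v -> isotropy_null x (r *: u + v).
Proof.
move=> /isotropy_nullP Hu /isotropy_nullP Hv; apply/isotropy_nullP => X f X0 sf.
by rewrite tangent_addE tangent_scaleE Hu // Hv // mulr0 addr0.
Qed.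

Lemma lieC (X Y : g) : lie X Y = - lie Y X.
Proof.
have lDl (A B D : g) : lie (A + B) D = lie A D + lie B D.
  by rewrite -[A]scale1r lie_linearl !scale1r.
have lDr (A B D : g) : lie D (A + B) = lie D A + lie D B.
  by rewrite -[A]scale1r lie_linearr !scale1r.
have := liexx (X + Y); rewrite lDl !lDr !liexx add0r addr0 => /eqP.
by rewrite addr_eq0 => /eqP.
Qed.

(** For [X] in the isotropy algebra, [X . zeta_Y(x)] is the value at [x] of
    [zeta_[X, Y]]; its vanishing means that [Y] normalizes that algebra. *)
Lemma orbit_null_eq0 (x : M) Y : asystatic M ->
  isotropy_null x (zeta Y x) -> zeta Y x = 0.
Proof.
move=> aM H; suff : isotropy x Y by [].
rewrite -aM => X X0; rewrite /isotropy /= lieC.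
rewrite -[lie X Y]scale1r -scaleN1r zetaZ scale1r.
rewrite zeta_bracket -isotropy_repE //; last exact: zeta_smooth.
by rewrite H // scaler0.
Qed.

End zeta.
End g_manifold.

(** * The splitting given by a trivialization *)

Section trivialization.
Variables (R : realType) (g : lieAlgebra R) (M S : gmanifold g).
Variable N : manifold R.
Variables (p : M -> N) (U : set N) (phi : M -> prod_charted N S).
Variable psi : prod_charted N S -> M.
Hypothesis HT : [/\ Defs.transitive S, submersion p, open U &
  local_trivialization p U phi psi].

Let trS : Defs.transitive S. Proof. by case: HT. Qed.
Let subp : submersion p. Proof. by case: HT. Qed.
Let oU : open U. Proof. by case: HT. Qed.
Let triv : local_trivialization p U phi psi. Proof. by case: HT. Qed.

Let HM := manifold_compatible M.
Let HN := manifold_compatible N.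
Let HS := manifold_compatible S.
Let sigma : M -> S := fun x => (phi x).2.

Lemma zero_prodE (z : prod_charted N S) (eta : field S)
    (f : prod_charted N S -> R) :
  smooth_at z f -> zero_prod eta z f = eta z.2 (f \o pair z.1).
Proof.
by case: z => n s sf; rewrite /zero_prod differentialE //; exact: slice_smooth.
Qed.

Lemma phi_smooth x : U (p x) -> smooth_map_at phi x.
Proof. by move=> Ux; have [_ /(_ x Ux)[]] := triv. Qed.

Lemma sigma_smooth x : U (p x) -> @smooth_map_at R M S sigma x.
Proof.
move=> Ux; apply: (@smooth_map_comp R M (prod_charted N S) S phi snd).
  exact: phi_smooth.
exact: snd_smooth.
Qed.

Lemma p_smooth x : smooth_map_at p x.
Proof. by case: subp. Qed.

Lemma near_U x : U (p x) -> \forall y \near x, U (p y).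
Proof.
by move=> Ux; have [cp _] := p_smooth x; apply: cp; apply: open_nbhs_nbhs.
Qed.

Lemma near_fst_phi x : U (p x) -> \forall y \near x, (phi y).1 = p y.
Proof. by move=> Ux; have [H _ _ _] := triv; apply: filterS (near_U Ux). Qed.

Lemma near_sigma x (P : S -> Prop) :
  U (p x) -> (\forall s \near sigma x, P s) ->
  \forall y \near x, P (sigma y).
Proof. by move=> Ux Ps; have [cs _] := sigma_smooth Ux; exact: cs. Qed.

Lemma smooth_p x (f : N -> R) : smooth_at (p x) f -> smooth_at x (f \o p).
Proof. by have [_ +] := p_smooth x; exact. Qed.

Lemma smooth_sigma x (f : S -> R) : U (p x) ->
  smooth_at (sigma x) f -> smooth_at x (f \o sigma).
Proof. by move=> Ux; have [_ +] := sigma_smooth Ux; exact. Qed.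

Lemma zeta_phi X x (F : prod_charted N S -> R) :
  U (p x) -> smooth_at (phi x) F ->
  zeta X x (F \o phi) = zeta X (sigma x) (F \o pair (phi x).1).
Proof.
move=> Ux sF; have [_ _ _ H] := triv.
rewrite -(@differentialE R M (prod_charted N S) phi) //; last exact: phi_smooth.
by rewrite H // zero_prodE.
Qed.

Lemma zeta_p X x (f : N -> R) : U (p x) -> smooth_at (p x) f ->
  zeta X x (f \o p) = 0.
Proof.
move=> Ux sf; have fx := nbhs_singleton (near_fst_phi Ux).
have sF : smooth_at (phi x) (f \o fst).
  have [_ s1] := @fst_smooth R N S (phi x).
  by apply: s1; rewrite fx.
rewrite (@tangent_near _ _ _ _ _ ((f \o fst) \o phi)).
- by rewrite zeta_phi // (_ : _ \o pair _ = cst (f (phi x).1)) ?tangent_cst.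
- exact: smooth_p.
- by have [_ s] := phi_smooth Ux; exact: s.
- by apply: filterS (near_fst_phi Ux) => y /= ->.
Qed.

Lemma zeta_sigma X x (f : S -> R) : U (p x) -> smooth_at (sigma x) f ->
  zeta X x (f \o sigma) = zeta X (sigma x) f.
Proof.
move=> Ux sf; have [_ s2] := @snd_smooth R N S (phi x).
by rewrite -[f \o sigma]/((f \o snd) \o phi) zeta_phi //; exact: s2.
Qed.

Definition vertical (x : M) (v : tangent x) :=
  forall f : N -> R, smooth_at (p x) f -> v (f \o p) = 0.

Definition horizontal (x : M) (v : tangent x) :=
  forall f : S -> R, smooth_at (sigma x) f -> v (f \o sigma) = 0.

(** The differential of [phi] sends such a vector to one killed by all functions
    pulled back from either factor, and [phi] is locally invertible. *)
Lemma vertical_horizontal_eq0 x (v : tangent x) : U (p x) ->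
  vertical v -> horizontal v -> v = 0.
Proof.
move=> Ux vv hv; have sphi := phi_smooth Ux.
have [_ sp] := sphi; have fx := nbhs_singleton (near_fst_phi Ux).
have dv0 : differential phi v = 0.
  apply: tangent_prod_eq0 => // f sf.
    have [_ s1] := @fst_smooth R N S (phi x).
    rewrite differentialE //; last exact: s1.
    rewrite fx in sf; rewrite -(vv f sf); apply: tangent_near.
    - by apply: sp; apply: s1; rewrite fx.
    - exact: smooth_p.
    - by apply: filterS (near_fst_phi Ux) => y /= ->.
  have [_ s2] := @snd_smooth R N S (phi x).
  by rewrite differentialE //; [exact: hv|exact: s2].
apply: tangent_ext => f sf; rewrite tangent_zeroE.
have [_ /(_ x Ux)[_ psK] Hpsi _] := triv.
have U1 : U (phi x).1 by rewrite fx.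
have [[_ spsi] _ _] := Hpsi _ U1.
have sF : smooth_at (phi x) (f \o psi) by apply: spsi; rewrite psK.
rewrite (@tangent_near _ _ _ v _ ((f \o psi) \o phi)) //.
- by rewrite -(differentialE v sphi sF) dv0.
- exact: sp.
- by apply: filterS (near_U Ux) => y Uy /=; have [_ /(_ y Uy)[_ ->]] := triv.
Qed.

(** By transitivity [zeta_X] and [v] have, for some [X], the same image in the
    tangent space of [S]. *)
Lemma horizontal_part x (v : tangent x) : U (p x) ->
  exists X, horizontal (v - zeta X x).
Proof.
move=> Ux; have [X HX] := trS (differential sigma v).
exists X => f sf; rewrite tangent_addE tangent_oppE zeta_sigma // HX.
by rewrite differentialE ?subrr //; exact: sigma_smooth.
Qed.

Lemma vertical_orbit x (v : tangent x) : U (p x) -> vertical v ->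
  exists X, v = zeta X x.
Proof.
move=> Ux vv; have [X hX] := horizontal_part v Ux; exists X.
apply/eqP; rewrite -subr_eq0; apply/eqP.
apply: vertical_horizontal_eq0 => // f sf.
by rewrite tangent_addE tangent_oppE vv // zeta_p // subrr.
Qed.

Lemma near_smooth_p x (f : N -> R) : smooth_at (p x) f ->
  \forall y \near x, smooth_at (p y) f.
Proof.
by move=> sf; have [cp _] := p_smooth x; exact: cp (smooth_at_join sf).
Qed.

Lemma near_smooth_sigma x (f : S -> R) : U (p x) -> smooth_at (sigma x) f ->
  \forall y \near x, smooth_at (sigma y) f.
Proof. by move=> Ux sf; exact: (near_sigma Ux (smooth_at_join sf)). Qed.

Lemma apply_zeta_p X x (v : tangent x) (f : N -> R) :
  U (p x) -> smooth_at (p x) f ->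
  v (fun y => zeta X y (f \o p)) = 0.
Proof.
move=> Ux sf; rewrite -(tangent_cst v 0); apply: tangent_near.
- apply: smooth_field_app; [exact: zeta_smooth|exact: smooth_p].
- exact: smooth_at_cst.
- by apply: filterS2 (near_U Ux) (near_smooth_p sf) => y Uy sy; exact: zeta_p.
Qed.

Lemma apply_zeta_sigma X x (v : tangent x) (f : S -> R) : U (p x) ->
  smooth_at (sigma x) f ->
  v (fun y => zeta X y (f \o sigma)) = v ((fun s => zeta X s f) \o sigma).
Proof.
move=> Ux sf; apply: tangent_near.
- apply: smooth_field_app; [exact: zeta_smooth|exact: smooth_sigma].
- apply: smooth_sigma => //; apply: smooth_field_app => //.
  exact: zeta_smooth.
- apply: filterS2 (near_U Ux) (near_smooth_sigma Ux sf) => y Uy sy.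
  exact: zeta_sigma.
Qed.

(** [X.v] sends [f o p] to [- v (zeta_X (f o p))], and fundamental fields kill
    [f o p]. *)
Lemma isotropy_rep_vertical x X (v : tangent x) : U (p x) -> isotropy x X ->
  vertical (isotropy_rep X v).
Proof.
move=> Ux X0 f sf; rewrite isotropy_rep_app //; last exact: smooth_p.
by rewrite apply_zeta_p // oppr0.
Qed.

Lemma horizontal_null x (v : tangent x) : U (p x) -> horizontal v ->
  isotropy_null x v.
Proof.
move=> Ux hv X X0; apply: vertical_horizontal_eq0 => //.
  exact: isotropy_rep_vertical.
move=> f sf; rewrite isotropy_rep_app //; last exact: smooth_sigma.
rewrite apply_zeta_sigma // hv ?oppr0 //.
by apply: smooth_field_app => //; exact: zeta_smooth.
Qed.

(** Subtracting the horizontal part leaves some [zeta_X(x)] on which the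
    isotropy representation vanishes as well. *)
Lemma null_horizontal x (v : tangent x) : asystatic M -> U (p x) ->
  isotropy_null x v -> horizontal v.
Proof.
move=> aM Ux nv; have [X hX] := horizontal_part v Ux.
have nX : isotropy_null x (zeta X x).
  rewrite (_ : zeta X x = -1 *: (v - zeta X x) + v); last first.
    by rewrite scaleN1r opprB subrK.
  by apply: isotropy_null_comb => //; exact: horizontal_null.
by move: hX; rewrite (orbit_null_eq0 aM nX) subr0.
Qed.

(** Choose [X_j] in the Lie algebra that induce at [sigma x] the coordinate
    fields of a chart of [S]. The matrix [A] of their components in that chart
    is the identity at [x], so it stays invertible nearby, and the coefficients
    [b] solve [A b = w] with [w] the components of the image of [xi]. *)
Lemma horizontal_part_smooth x (xi : field M) :
  U (p x) -> smooth_field_at xi x ->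
  exists n (X : 'I_n -> g) (b : 'I_n -> M -> R),
    (forall j, smooth_at x (b j)) /\
    \forall y \near x, horizontal (xi y - zeta (\sum_j b j y *: X j) y).
Proof.
move=> Ux sxi; have [c ac cx] := compat_cover HS (sigma x).
pose u i : S -> R := fun s => cmap c s 0 i.
have [X HX] := choice (fun j : 'I_(cdim c) => trS (chart_field j (sigma x))).
pose A y := \matrix_(i, j) zeta (X j) y (u i \o sigma).
have su i y : U (p y) -> cdom c (sigma y) -> smooth_at y (u i \o sigma).
  by move=> Uy cy; apply: smooth_sigma => //; exact: chart_coord_smooth.
have sA i j : smooth_at x (fun y => A y i j).
  under eq_fun do rewrite mxE.
  by apply: smooth_field_app; [exact: zeta_smooth|exact: su].
have Ax : A x = 1%:M.
  apply/matrixP => i j; rewrite !mxE zeta_sigma //;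
    last exact: chart_coord_smooth.
  by rewrite HX chart_field_coord // eq_sym.
have sV i j : smooth_at x (fun y => invmx (A y) i j).
  by apply: smooth_at_invmx => //; rewrite Ax unitmx1.
have sdet : {for x, continuous (fun y => \det (A y))}.
  by apply: smooth_continuous => //; exact: smooth_at_det.
have nA : \forall y \near x, \det (A y) != 0.
  by apply: cvgr_neq0 sdet _; rewrite Ax det1 oner_eq0.
exists (cdim c), X, (fun j =>
  \sum_i ((fun y => invmx (A y) j i) * (fun y => xi y (u i \o sigma)))).
split=> [j|].
  apply: smooth_at_sum => i _; apply: smooth_atM => //.
  by apply: smooth_field_app => //; exact: su.
have ncs := near_sigma Ux (near_cdom HS ac cx).
apply: filterS3 nA (near_U Ux) ncs => y Ay Uy cy.
set v := xi y - _.
have dv : differential sigma v = 0.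
  apply: (tangent_chart_eq0 HS ac cy) => i.
  have ssy := sigma_smooth Uy.
  rewrite differentialE //; last exact: chart_coord_smooth.
  pose w : 'cV[R]_(cdim c) := \col_i xi y (u i \o sigma).
  have Aw : A y *m (invmx (A y) *m w) = w.
    by rewrite mulmxA mulmxV ?mul1mx // unitmxE unitfE.
  have := congr1 (fun B : 'cV[R]_(cdim c) => B i 0) Aw; rewrite [RHS]mxE => Ewi.
  rewrite /v tangent_addE tangent_oppE zeta_sum -[X in X - _]Ewi.
  apply/eqP; rewrite subr_eq0; apply/eqP.
  rewrite tangent_sumE mxE; apply: eq_bigr => j _.
  rewrite tangent_scaleE mulrC !mxE fct_sumE; congr (_ * _).
  by apply: eq_bigr => k _; rewrite mxE.
move=> f sf; rewrite -(differentialE v (sigma_smooth Uy) sf).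
by rewrite dv.
Qed.

End trivialization.

(** * The connection *)

Section connection.
Variables (R : realType) (g : lieAlgebra R) (M : gmanifold g).
Hypotheses (aM : asystatic M) (ltM : locally_trivial M).
Let HM := manifold_compatible M.

Lemma trivialization_at (x : M) :
  exists (S : gmanifold g) (N : manifold R) (p : M -> N) (U : set N)
    (phi : M -> prod_charted N S) (psi : prod_charted N S -> M),
    [/\ Defs.transitive S, submersion p, open U &
      local_trivialization p U phi psi] /\ U (p x).
Proof.
have [S [N [p [_ trS subp _ triv]]]] := ltM.
have [U [phi [psi [oU Ux H]]]] := triv (p x).
by exists S, N, p, U, phi, psi.
Qed.

Lemma null_part (x : M) (v : tangent x) :
  exists X, isotropy_null x (v - zeta X x).
Proof.
have [S [N [p [U [phi [psi [H Ux]]]]]]] := trivialization_at x.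
have [X hX] := horizontal_part H v Ux.
by exists X; exact: (horizontal_null H Ux hX).
Qed.

(** The projection onto the orbit directions along [isotropy_null x], whose
    definition involves no trivialization. The element [X] is determined only
    up to isotropy, its value [zeta X x] is unique ([orbit_proj_eq]). *)
Definition orbit_proj (x : M) (v : tangent x) : tangent x :=
  zeta (projT1 (cid (null_part v))) x.

Lemma orbit_projB_null (x : M) (v : tangent x) :
  isotropy_null x (v - orbit_proj v).
Proof. by rewrite /orbit_proj; case: cid. Qed.

Lemma orbit_proj_eq (x : M) (v : tangent x) X :
  isotropy_null x (v - zeta X x) -> orbit_proj v = zeta X x.
Proof.
move=> nX; have := orbit_projB_null v; rewrite /orbit_proj.
case: cid => /= Y _ nY.
have E : zeta (X - Y) x = zeta X x - zeta Y x.
  by rewrite zetaD -scaleN1r zetaZ scaleN1r.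
apply/eqP; rewrite eq_sym -subr_eq0 -E; apply/eqP; apply: orbit_null_eq0 => //.
rewrite E (_ : _ - _ = -1 *: (v - zeta X x) + (v - zeta Y x)).
  exact: isotropy_null_comb.
by rewrite scaleN1r opprB addrA subrK.
Qed.

Lemma orbit_proj_linear (x : M) : linear (@orbit_proj x).
Proof.
move=> r u v; have [X nX] := null_part u; have [Y nY] := null_part v.
rewrite (orbit_proj_eq nX) (orbit_proj_eq nY) -zeta_linear.
apply: orbit_proj_eq.
rewrite zeta_linear (_ : _ - _ = r *: (u - zeta X x) + (v - zeta Y x)).
  exact: isotropy_null_comb.
by rewrite scalerBr opprD addrACA.
Qed.

HB.instance Definition _ (x : M) :=
  GRing.isLinear.Build R (tangent x) (tangent x)
  *:%R (@orbit_proj x) (@orbit_proj_linear x).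

(** Near [x] the projection is the one of a single trivialization, because all
    trivializations have the same horizontal vectors. *)
Lemma orbit_proj_smooth (x : M) (xi : field M) : smooth_field_at xi x ->
  smooth_field_at (fun y => orbit_proj (xi y)) x.
Proof.
move=> sxi; have [S [N [p [U [phi [psi [H Ux]]]]]]] := trivialization_at x.
have [n [X [b [sb nh]]]] := horizontal_part_smooth H Ux sxi.
apply: (@smooth_field_at_near _ _ HM (fun y => \sum_j b j y *: zeta (X j) y)).
  apply: filterS2 (near_U H Ux) nh => y Uy hy.
  rewrite -zeta_sum; apply/esym/orbit_proj_eq.
  exact: (horizontal_null H Uy hy).
by apply: smooth_field_comb => // j; exact: zeta_smooth.
Qed.

Definition orbit_connection : form1 M :=
  @Form1 R g M (fun x => @orbit_proj x) orbit_proj_smooth.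

Lemma orbit_proj0P (x : M) (v : tangent x) :
  orbit_proj v = 0 <-> isotropy_null x v.
Proof.
split=> [v0|nv]; first by have := orbit_projB_null v; rewrite v0 subr0.
by rewrite (@orbit_proj_eq _ _ 0) zeta0 // subr0.
Qed.

Lemma orbit_proj_zeta X (x : M) : orbit_proj (zeta X x) = zeta X x.
Proof.
by apply: orbit_proj_eq; rewrite subrr; apply/orbit_proj0P; exact: linear0.
Qed.

(** For invariance, [[zeta_X, Phi eta]] is vertical and differs from
    [[zeta_X, eta]] by a horizontal vector, hence is its projection. *)
Lemma orbit_connection_principal : principal_connection orbit_connection.
Proof.
split => [x v|x|X x eta se] /=.
- by rewrite {2}/orbit_proj orbit_proj_zeta.
- apply/seteqP; split => [_ [v _ <-]|_ [X _ <-]].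
    by rewrite /orbit_proj; eexists.
  by exists (zeta X x) => //; exact: orbit_proj_zeta.
have [S [N [p [U [phi [psi [H Ux]]]]]]] := trivialization_at x.
have spe := orbit_proj_smooth se.
have sz := zeta_smooth X x.
have nh : \forall y \near x, horizontal phi (eta y - orbit_proj (eta y)).
  apply: filterS (near_U H Ux) => y Uy.
  by apply: (null_horizontal H) => //; exact: orbit_projB_null.
have vert : vertical p (bracket (zeta X) (fun y => orbit_proj (eta y)) x).
  move=> f sf; apply: bracket_kill => //; first exact: (smooth_p H).
    apply: filterS2 (near_U H Ux) (near_smooth_p H sf) => y Uy sy.
    exact: zeta_p H _ _ _ Uy sy.
  apply: filterS2 (near_U H Ux) (near_smooth_p H sf) => y Uy sy.
  exact: zeta_p H _ _ _ Uy sy.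
have [Y EY] := vertical_orbit H Ux vert.
rewrite /lie_derivative /= EY; apply/eqP; rewrite subr_eq0 eq_sym; apply/eqP.
apply: orbit_proj_eq; rewrite -EY; apply: (horizontal_null H Ux).
move=> f sf; have sfs := smooth_sigma H Ux sf.
have E y : U (p y) -> horizontal phi (eta y - orbit_proj (eta y)) ->
    forall f, smooth_at (phi y).2 f ->
    eta y (f \o (fun x => (phi x).2)) =
    orbit_proj (eta y) (f \o (fun x => (phi x).2)).
  move=> Uy hy h sh; apply/eqP; rewrite -subr_eq0; apply/eqP.
  exact: hy h sh.
have sF : smooth_at (phi x).2 (fun s => zeta X s f).
  by apply: smooth_field_app => //; exact: zeta_smooth.
rewrite tangent_addE tangent_oppE !bracketE //.
rewrite (@tangent_near _ _ _ (zeta X x) _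
  (fun y => orbit_proj (eta y) (f \o (fun x => (phi x).2)))).
- by rewrite !(apply_zeta_sigma H) // (E x Ux (nbhs_singleton nh) _ sF) subrr.
- exact: smooth_field_app.
- exact: smooth_field_app.
- apply: filterS3 (near_U H Ux) nh (near_smooth_sigma H Ux sf) => y Uy hy sy.
  exact: E.
Qed.

(** If [v] is in the kernel of [Psi] and [X] is in the isotropy algebra, then
    invariance gives [Psi (X.v) = X.(Psi v) = 0], while [X.v] is vertical and so
    fixed by [Psi]. Hence the kernel of [Psi] is contained in
    [isotropy_null x]. *)
Lemma orbit_connection_unique (Psi : form1 M) : principal_connection Psi ->
  forall (x : M) (v : tangent x), Psi x v = orbit_connection x v.
Proof.
move=> [idem ran inv] x.
have orbP X : Psi x (zeta X x) = zeta X x.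
  have [u _ <-] : range (Psi x) (zeta X x) by rewrite ran; exists X.
  exact: idem.
have kerP (v : tangent x) : Psi x v = 0 -> isotropy_null x v.
  move=> v0 X X0; have [eta [se ev EX]] := isotropy_rep_ext v X0.
  have := inv X x eta se; rewrite /lie_derivative -EX.
  have sPe := form_smooth Psi se.
  rewrite -(isotropy_repE X0 sPe) ev v0 => /eqP.
  have -> : isotropy_rep X (0 : tangent x) = 0.
    apply: tangent_ext => f sf; rewrite isotropy_rep_app // tangent_zeroE.
    by rewrite oppr0.
  rewrite sub0r oppr_eq0 => /eqP.
  have [S [N [p [U [phi [psi [H Ux]]]]]]] := trivialization_at x.
  have := isotropy_rep_vertical H v Ux X0.
  by move=> /(vertical_orbit H Ux)[Y ->]; rewrite orbP.
move=> v; have [X _ EX] : orbit_space x (Psi x v) by rewrite -ran; exists v.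
rewrite -EX; apply/esym/orbit_proj_eq; rewrite EX.
by apply: kerP; rewrite linearB /= idem subrr.
Qed.

(** Horizontal fields kill [f o sigma], and so does their bracket. *)
Lemma orbit_connection_flat : flat orbit_connection.
Proof.
move=> x xi eta sxi se; rewrite /curvature /=; apply/orbit_proj0P.
have [S [N [p [U [phi [psi [H Ux]]]]]]] := trivialization_at x.
apply: (horizontal_null H Ux) => f sf.
have hor (zet : field M) : \forall y \near x,
    (zet y - orbit_proj (zet y)) (f \o (fun x => (phi x).2)) = 0.
  apply: filterS2 (near_U H Ux) (near_smooth_sigma H Ux sf) => y Uy sy.
  apply: (null_horizontal H aM Uy) => //; exact: orbit_projB_null.
apply: (@bracket_kill _ _ S) => //.
- by apply: smooth_fieldB => //; exact: orbit_proj_smooth.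
- by apply: smooth_fieldB => //; exact: orbit_proj_smooth.
- exact: (smooth_sigma H Ux sf).
Qed.

End connection.

Theorem proposition6p2 (R : realType) (g : lieAlgebra R) (M : gmanifold g) :
  asystatic M -> locally_trivial M ->
  exists Phi : form1 M,
    [/\ principal_connection Phi,
        forall Psi : form1 M, principal_connection Psi ->
          forall (x : M) (v : tangent x), Psi x v = Phi x v,
        flat Phi &
        forall x : M, horizontal_space Phi x = isotropy_null x].
Proof.
move=> aM ltM; exists (orbit_connection aM ltM); split.
- exact: orbit_connection_principal.
- exact: orbit_connection_unique.
- exact: orbit_connection_flat.
- move=> x; apply/seteqP; split => v; first exact: (orbit_proj0P aM ltM v).1.
  exact: (orbit_proj0P aM ltM v).2.
Qed.
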